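(* For any $K$-variety $X$, there is a natural closed embedding (over $X$) of the prolongation $X^{(1)}$ into the prolongation cone $CX$.
   Context: $(K,\delta)$ is an algebraically closed differential field (a field with a derivation $\delta:K\to K$) containing an element $e$ with $\delta(e)=1$. A variety is an integral, separated $K$-scheme of finite type. $\Omega_X$ denotes the sheaf of absolute Kähler differentials (over $\mathbb{Z}$). The prolongation of $X$ is the $X$-scheme $X^{(1)}=\mathbf{Spec}\,(\mathrm{Sym}(\Omega_X)/I)$, where $I$ is the ideal sheaf generated locally by the elements $da-\delta(a)$, $a\in K$. For a $K$-algebra $R$, the module of $\tau$-differentials $\Omega^\tau_R$ is the $R$-module generated by symbols $\tau r$, $r\in R$, with relations $\tau(r+s)=\tau r+\tau s$, $\tau(rs)=r\,\tau s+s\,\tau r$ for $r,s\in R$, and $\delta(a)\tau b=\delta(b)\tau a$ for $a,b\in K$. $\Omega^\tau_X$ is the quasi-coherent sheaf on $X$ whose sections on an open affine $\mathrm{Spec}\,R$ are $\Omega^\tau_R$. The prolongation cone of $X$ is $CX=\mathbf{Spec}\,\mathrm{Sym}(\Omega^\tau_X)$. *)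

(* Defs.v *)
From HB Require Import structures.
From mathcomp Require Import all_boot all_order all_algebra.
From mathcomp Require Import generic_quotient.
From mathcomp Require Import mathcomp_extra boolp classical_sets functions.
From mathcomp Require Import filter topology_structure.

Set Implicit Arguments.
Unset Strict Implicit.
Unset Printing Implicit Defensive.

Import GRing.Theory.
Local Open Scope classical_set_scope.
Local Open Scope ring_scope.
Local Open Scope quotient_scope.

(* Rings are commutative with 1 and may be zero (comPzRingType), as needed   *)
(* for the sections of a sheaf over the empty set.                           *)

Record opens (T : topologicalType) := Opens {
  oset :> T -> Prop;
  oset_open : open oset }.

Definition openT (T : topologicalType) : opens T := Opens (@openT T).

Definition preim (S T : topologicalType) (f : S -> T) (cf : continuous f)
    (V : opens T) : opens S :=
  Opens ((continuousP f).1 cf V (@oset_open T V)).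

Definition invertible (A : comPzRingType) (a : A) := exists b, a * b = 1.

(* The gluing axiom takes arbitrary common open subsets W of C i and C j     *)
(* instead of the intersection.                                              *)
Record ringed_space := RingedSpace {
  space :> topologicalType;
  sect : opens space -> comPzRingType;
  res : forall U V : opens space, V `<=` U -> {rmorphism sect U -> sect V};
  res_id : forall (U : opens space) (h : U `<=` U) s, res h s = s;
  res_comp : forall (U V W : opens space)
    (hVU : V `<=` U) (hWV : W `<=` V) (hWU : W `<=` U) s,
    res hWV (res hVU s) = res hWU s;
  sect_separated : forall (U : opens space) (I : Type) (C : I -> opens space)
    (hC : forall i, C i `<=` U),
    (forall x, U x -> exists i, C i x) ->
    forall s t : sect U, (forall i, res (hC i) s = res (hC i) t) -> s = t;
  sect_glue : forall (U : opens space) (I : Type) (C : I -> opens space)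
    (hC : forall i, C i `<=` U),
    (forall x, U x -> exists i, C i x) ->
    forall s : (forall i, sect (C i)),
    (forall i j (W : opens space) (hi : W `<=` C i) (hj : W `<=` C j),
      res hi (s i) = res hj (s j)) ->
    exists t : sect U, forall i, res (hC i) t = s i }.
Arguments res {r U V} h.
Arguments sect : clear implicits.

(* The germ of s at x is invertible in the stalk at x. *)
Definition inv_at (X : ringed_space) (U : opens X) (s : sect X U) (x : X) :=
  exists (V : opens X) (h : V `<=` U), V x /\ invertible (res h s).

(* The stalk at x is a local ring: it is nonzero and its noninvertible       *)
(* elements are stable under sum (any two germs at x have representatives    *)
(* over a common open set).                                                  *)
Definition local_stalk (X : ringed_space) (x : X) :=
  forall U : opens X, U x ->
    ~ inv_at (0 : sect X U) x /\
    forall s t : sect X U, inv_at (s + t) x -> inv_at s x \/ inv_at t x.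

Record lrspace := LRSpace {
  rspace :> ringed_space;
  stalk_local : forall x : rspace, local_stalk x }.

Lemma inv_at_open (X : ringed_space) (U : opens X) (s : sect X U) :
  open [set x | inv_at s x].
Proof.
rewrite openE => x [V [h [Vx iV]]].
rewrite /interior nbhsE; exists V => [|y Vy]; last by exists V, h.
by split=> //; exact: oset_open.
Qed.

Definition basic_open (X : ringed_space) (U : opens X) (s : sect X U) :
  opens X := Opens (inv_at_open s).

Lemma basic_open_sub (X : ringed_space) (U : opens X) (s : sect X U) :
  basic_open s `<=` U.
Proof. by move=> x [V [h [Vx _]]]; exact: h. Qed.

Record mor (X Y : lrspace) := Mor {
  mor_fun :> X -> Y;
  mor_cont : continuous mor_fun;
  comor : forall V : opens Y,
    {rmorphism sect Y V -> sect X (preim mor_cont V)};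
  comor_res : forall (V W : opens Y) (h : W `<=` V)
    (h' : preim mor_cont W `<=` preim mor_cont V) s,
    comor W (res h s) = res h' (comor V s);
  comor_local : forall (V : opens Y) (s : sect Y V) x,
    V (mor_fun x) -> inv_at (comor V s) x -> inv_at s (mor_fun x) }.

Definition pre (X Y : lrspace) (f : mor X Y) : opens Y -> opens X :=
  preim (@mor_cont X Y f).

(* The map O_Y(V) -> O_X(U) induced by f when f(U) is contained in V. *)
Definition pull (X Y : lrspace) (f : mor X Y) (V : opens Y) (U : opens X)
    (h : U `<=` pre f V) : {rmorphism sect Y V -> sect X U} :=
  res h \o comor f V.

(* Equality of morphisms, avoiding transport along f = g. *)
Definition mor_eq (X Y : lrspace) (f g : mor X Y) :=
  f =1 g /\
  forall (V : opens Y) (U : opens X) (hf : U `<=` pre f V) (hg : U `<=` pre g V)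
    s, pull hf s = pull hg s.

Section Identity.
Variable X : lrspace.

Lemma id_cont : continuous (@id X). Proof. by move=> x; exact. Qed.

Let h (V : opens X) : preim id_cont V `<=` V. Proof. by []. Qed.

Lemma id_comor_res (V W : opens X) (hWV : W `<=` V)
    (h' : preim id_cont W `<=` preim id_cont V) s :
  res (@h W) (res hWV s) = res h' (res (@h V) s).
Proof.
by rewrite (res_comp _ _ (subset_trans (@h W) hWV))
           (res_comp _ _ (subset_trans (@h W) hWV)).
Qed.

Lemma id_comor_local (V : opens X) (s : sect X V) (x : X) :
  V x -> inv_at (res (@h V) s) x -> inv_at s x.
Proof.
move=> Vx [W [hW [Wx iW]]]; exists W, (subset_trans hW (@h V)); split=> //.
by rewrite -(res_comp (@h V) hW).
Qed.

Definition id_mor : mor X X := Mor id_comor_res id_comor_local.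
End Identity.

Section Composition.
Variables (X Y Z : lrspace) (g : mor Y Z) (f : mor X Y).

Lemma comp_cont : continuous (g \o f).
Proof. by move=> x; apply: continuous_comp; exact: mor_cont. Qed.

Let h (V : opens Z) : preim comp_cont V `<=` pre f (pre g V).
Proof. by []. Qed.

Let k (V : opens Z) : {rmorphism sect Z V -> sect X (preim comp_cont V)} :=
  pull (@h V) \o comor g V.

Lemma comp_comor_res (V W : opens Z) (hWV : W `<=` V)
    (h' : preim comp_cont W `<=` preim comp_cont V) s :
  k W (res hWV s) = res h' (k V s).
Proof.
rewrite /k /=.
have h1 : pre g W `<=` pre g V by move=> y; exact: hWV.
have h2 : pre f (pre g W) `<=` pre f (pre g V) by move=> y; exact: hWV.
rewrite (comor_res _ h1) (comor_res _ h2).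
have h3 : preim comp_cont W `<=` pre f (pre g V) by move=> y; exact: hWV.
by rewrite (res_comp _ _ h3) (res_comp _ _ h3).
Qed.

Lemma comp_comor_local (V : opens Z) (s : sect Z V) (x : X) :
  V ((g \o f) x) -> inv_at (k V s) x -> inv_at s ((g \o f) x).
Proof.
move=> Vx [W [hW [Wx iW]]]; apply: comor_local => //.
apply: comor_local => //; exists W, (subset_trans hW (@h V)); split=> //.
by rewrite -(res_comp (@h V) hW).
Qed.

Definition comp_mor : mor X Z := Mor comp_comor_res comp_comor_local.
End Composition.

Definition prime_ideal (A : comPzRingType) (p : set A) :=
  [/\ p 0, forall a b, p a -> p b -> p (a + b), forall a b, p b -> p (a * b),
      ~ p 1 & forall a b, p (a * b) -> p a \/ p b].

(* psi : A -> B is the localization of A at the powers of a. *)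
Definition is_localization (A B : comPzRingType) (a : A)
    (psi : {rmorphism A -> B}) :=
  [/\ invertible (psi a),
      forall b, exists n c, b * psi a ^+ n = psi c
    & forall c, psi c = 0 -> exists n, a ^+ n * c = 0].

(* phi : A -> O_X(U) identifies (U, O_X|U) with Spec A: the points of U are  *)
(* the primes of A (x being sent to the prime of the a in A with phi a not   *)
(* invertible at x), the D(a) = {x | phi a is invertible at x} form a base   *)
(* of the topology of U, and O_X(D(a)) is the ring A_a.                      *)
Definition is_Spec (X : lrspace) (U : opens X) (A : comPzRingType)
    (phi : {rmorphism A -> sect X U}) :=
  [/\ forall p : set A, prime_ideal p ->
        exists! x, U x /\ p = [set a | ~ inv_at (phi a) x],
      forall (V : opens X) x, V `<=` U -> V x ->
        exists a, inv_at (phi a) x /\ basic_open (phi a) `<=` V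
    & forall a, is_localization a
        (res (@basic_open_sub X U (phi a)) \o phi)].

Definition affine_open (X : lrspace) (U : opens X) :=
  @is_Spec X U (sect X U) idfun.

Record scheme := Scheme {
  lrs :> lrspace;
  scheme_affine : forall x : lrs, exists U : opens lrs, U x /\ affine_open U }.

Definition integral_scheme (X : lrspace) :=
  (exists x : X, True) /\
  forall U : opens X, (exists x, U x) ->
    (1 : sect X U) <> 0 /\
    forall s t : sect X U, s * t = 0 -> s = 0 \/ t = 0.

Definition finitely_generated (A B : comPzRingType) (phi : {rmorphism A -> B}) :=
  exists n (b : 'I_n -> B), forall S : set B,
    (forall a, S (phi a)) -> (forall i, S (b i)) ->
    (forall x y, S x -> S y -> S (x + y)) ->
    (forall x y, S x -> S y -> S (x * y)) ->
    forall x, S x.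

Definition finite_type (X Y : lrspace) (f : mor X Y) :=
  forall y : Y, exists V : opens Y, [/\ V y, affine_open V &
    exists n (U : 'I_n -> opens X),
      (forall x, pre f V x -> exists i, U i x) /\
      forall i, affine_open (U i) /\
        exists h : U i `<=` pre f V, finitely_generated (pull h)].

Definition closed_immersion (X Y : lrspace) (f : mor X Y) :=
  [/\ injective f,
      closed (range f),
      forall U : opens X, exists V : opens Y, forall x, U x <-> V (f x)
    & forall (V : opens Y) (t : sect X (pre f V)) y, V y ->
        exists (W : opens Y) (h : W `<=` V) (h' : pre f W `<=` pre f V)
               (s : sect Y W),
          W y /\ comor f W s = res h' t].

Definition is_fibre_product (X Y S Z : lrspace) (f : mor X S) (g : mor Y S)
    (p : mor Z X) (q : mor Z Y) :=
  mor_eq (comp_mor f p) (comp_mor g q) /\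
  forall (T : scheme) (a : mor T X) (b : mor T Y),
    mor_eq (comp_mor f a) (comp_mor g b) ->
    exists u : mor T Z,
      [/\ mor_eq (comp_mor p u) a, mor_eq (comp_mor q u) b &
          forall v : mor T Z, mor_eq (comp_mor p v) a ->
            mor_eq (comp_mor q v) b -> mor_eq v u].

Definition separated (X : scheme) (S : lrspace) (f : mor X S) :=
  exists (Z : scheme) (p q : mor Z X) (diag : mor X Z),
    [/\ is_fibre_product f f p q,
        mor_eq (comp_mor p diag) (id_mor X),
        mor_eq (comp_mor q diag) (id_mor X) & closed_immersion diag].

(* The spectrum of a field K is a one-point space; O(U) is realized as the   *)
(* ring of maps U -> K, which is the zero ring for U empty.                  *)

Definition point := unit.
HB.instance Definition _ := Choice.copy point unit.

HB.instance Definition _ := @isOpenTopological.Build point setT I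
  (fun _ _ _ _ => I) (fun _ _ _ => I).

Lemma point_open (A : set point) : open A.
Proof. by []. Qed.

Section SpecField.
Variable K : fieldType.

Definition psect (U : opens point) : comPzRingType := {x : point | U x} -> K.

Section Restriction.
Variables (U V : opens point) (h : V `<=` U).

Definition pres (s : psect U) : psect V :=
  fun x => s (exist _ (sval x) (h (svalP x))).

Lemma pres_zmod_morphism : zmod_morphism pres. Proof. by []. Qed.
Lemma pres_monoid_morphism : monoid_morphism pres. Proof. by []. Qed.

HB.instance Definition _ :=
  GRing.isZmodMorphism.Build _ _ pres pres_zmod_morphism.
HB.instance Definition _ :=
  GRing.isMonoidMorphism.Build _ _ pres pres_monoid_morphism.
End Restriction.

Definition presm (U V : opens point) (h : V `<=` U) :
  {rmorphism psect U -> psect V} := pres h.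

Lemma psect_ext (U : opens point) (s : psect U) x y : sval x = sval y ->
  s x = s y.
Proof.
case: x y => [x hx] [y hy] /= exy; case: y / exy hy => hy.
by rewrite (Prop_irrelevance hx hy).
Qed.

Lemma pres_id (U : opens point) (h : U `<=` U) s : presm h s = s.
Proof. by apply/funext => x; exact: (@psect_ext _ s). Qed.

Lemma pres_comp (U V W : opens point)
    (hVU : V `<=` U) (hWV : W `<=` V) (hWU : W `<=` U) s :
  presm hWV (presm hVU s) = presm hWU s.
Proof. by apply/funext => x; exact: (@psect_ext _ s). Qed.

Lemma psect_separated (U : opens point) (I : Type) (C : I -> opens point)
    (hC : forall i, C i `<=` U) :
  (forall x, U x -> exists i, C i x) ->
  forall s t : psect U, (forall i, presm (hC i) s = presm (hC i) t) -> s = t.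
Proof.
move=> cov s t est; apply/funext => -[x Ux].
have [i Cix] := cov x Ux.
have /(congr1 (fun g => g (exist _ x Cix))) := est i.
by rewrite /= /pres (@psect_ext _ s _ (exist _ x Ux)) //
  (@psect_ext _ t _ (exist _ x Ux)).
Qed.

Lemma psect_glue (U : opens point) (I : Type) (C : I -> opens point)
    (hC : forall i, C i `<=` U) :
  (forall x, U x -> exists i, C i x) ->
  forall s : (forall i, psect (C i)),
  (forall i j (W : opens point) (hi : W `<=` C i) (hj : W `<=` C j),
    presm hi (s i) = presm hj (s j)) ->
  exists t : psect U, forall i, presm (hC i) t = s i.
Proof.
move=> cov s comp.
pose ix (x : {x | U x}) := projT1 (cid (cov _ (svalP x))).
have ixP x : C (ix x) (sval x) by rewrite /ix; case: cid.
exists (fun x => s (ix x) (exist _ (sval x) (ixP x))) => i.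
apply/funext => -[x Cix] /=; rewrite /pres /=.
set z := exist _ x _; set j := ix z.
pose W := Opens (@point_open [set y | C i y /\ C j y]).
have hi : W `<=` C i by move=> y [].
have hj : W `<=` C j by move=> y [].
have Wx : W x by split=> //; exact: (ixP z).
have /(congr1 (fun g => g (exist _ x Wx))) := comp j i W hj hi.
rewrite /= /pres /= => E; rewrite (@psect_ext _ (s j) _ (exist _ x (hj x (svalP (exist W x Wx))))) //.
by rewrite E; exact: (@psect_ext _ (s i)).
Qed.

Definition point_rs : ringed_space :=
  RingedSpace pres_id pres_comp psect_separated psect_glue.

Lemma psect_invertible (U : opens point) (s : psect U) :
  (forall x, s x != 0) -> invertible s.
Proof.
move=> s0; exists (fun x => (s x)^-1); apply/funext => x.
exact: (divff (s0 x)).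
Qed.

Lemma point_inv_at (U : opens point_rs) (s : sect point_rs U) (x : point)
  (Ux : U x) : inv_at s x <-> s (exist _ x Ux) != 0.
Proof.
split=> [[V [h [Vx [t /(congr1 (fun g => g (exist _ x Vx)))]]]]|sx].
  move=> st; apply/eqP => s0; have: (0 : K) = 1 :> K.
    rewrite -[RHS]st -(mul0r (t (exist _ x Vx))) -s0; congr (_ * _).
    exact: (@psect_ext _ s).
  by move/eqP; rewrite eq_sym oner_eq0.
exists U, (fun _ => id); split=> //; rewrite res_id.
apply: psect_invertible => -[y Uy].
by rewrite (@psect_ext _ s _ (exist _ x Ux)) //=; case: (x); case: (y).
Qed.

Lemma point_local (x : point_rs) : local_stalk x.
Proof.
move=> U Ux; split=> [/(point_inv_at _ Ux) /eqP //|s t].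
move=> /(point_inv_at _ Ux) st0.
have [s0|s0] := eqVneq (s (exist _ x Ux)) 0; last first.
  by left; apply/(point_inv_at _ Ux).
right; apply/(point_inv_at _ Ux); apply: contraNneq st0 => t0.
by apply/eqP; rewrite -[RHS]addr0 -{1}s0 -t0.
Qed.

Definition point_lrs : lrspace := LRSpace point_local.

Lemma point_affine (U : opens point_lrs) : U tt -> affine_open U.
Proof.
move=> Utt; pose u : {x | U x} := exist _ tt Utt.
have allu (x : {x | U x}) : x = u.
  by case: x => -[] Ux; rewrite /u (Prop_irrelevance Ux Utt).
have inv (s : sect point_lrs U) : inv_at s tt <-> s u <> 0.
  by rewrite (point_inv_at _ Utt); split => /eqP.
split.
- move=> p [p0 _ pM p1 _]; exists tt; split=> [|[] //]; split=> //.
  apply/seteqP; split=> a /= => [pa /inv au|].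
    apply: p1; have [b ab] : invertible a.
      by apply: psect_invertible => x; rewrite (allu x); exact/eqP.
    by rewrite -ab mulrC; exact: pM.
  move=> /(contra_not (inv a).2) /contrapT au.
  by rewrite (_ : a = 0) //; apply/funext => x; rewrite (allu x).
- move=> V [] VU Vtt; exists 1; split.
    by apply/inv; apply/eqP; exact: oner_neq0.
  by case.
- move=> a; split.
  + apply: psect_invertible => -[[] ax] /=.
    move/inv/eqP: (ax) => au; rewrite /pres /=.
    by rewrite (@psect_ext _ a _ u).
  + move=> b; exists 0%N.
    pose c : psect U := fun x => if pselect (basic_open a (sval x)) is left h
      then b (exist _ (sval x) h) else 0.
    exists c; rewrite expr0 mulr1; apply/funext => -[x ax] /=.
    rewrite /pres /c /=; case: pselect => // h; exact: (@psect_ext _ b).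
  + move=> c c0; have [au|/eqP au] := eqVneq (a u) 0.
      exists 1%N; rewrite expr1; apply/funext => x; rewrite (allu x).
      by rewrite -[RHS](mul0r (c u)) -au.
    exists 0%N; rewrite expr0 mul1r; apply/funext => x; rewrite (allu x).
    have ax : basic_open a tt by apply/inv.
    have /(congr1 (fun g => g (exist _ tt ax))) := c0.
    by rewrite /= /pres /= (@psect_ext _ c _ u).
Qed.

Lemma point_scheme_affine (x : point_lrs) :
  exists U : opens point_lrs, U x /\ affine_open U.
Proof. by exists (openT point_lrs); split=> //; exact: point_affine. Qed.

Definition Spec_field : scheme := Scheme point_scheme_affine.

Definition const_sect (a : K) : psect (openT point) := fun=> a.

Lemma const_sect_zmod_morphism : zmod_morphism const_sect. Proof. by []. Qed.
Lemma const_sect_monoid_morphism : monoid_morphism const_sect.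
Proof. by []. Qed.
HB.instance Definition _ :=
  GRing.isZmodMorphism.Build _ _ const_sect const_sect_zmod_morphism.
HB.instance Definition _ :=
  GRing.isMonoidMorphism.Build _ _ const_sect const_sect_monoid_morphism.

Definition const_sectm : {rmorphism K -> sect Spec_field (openT point)} :=
  const_sect.
End SpecField.

(* The R-module generated by the symbols g : G subject to the relations Rel: *)
(* formal expressions modulo the congruence generated by Rel and the module  *)
(* axioms.                                                                   *)
Section PresentedModule.
Variables (R : comPzRingType) (G : Type).

Inductive mterm :=
| Mgen of G
| Mzero
| Madd of mterm & mterm
| Mopp of mterm
| Mscale of R & mterm.

Variable Rel : mterm -> mterm -> Prop.

Inductive mcong : mterm -> mterm -> Prop :=
| mcong_rel x y : Rel x y -> mcong x y
| mcong_refl x : mcong x x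
| mcong_sym x y : mcong x y -> mcong y x
| mcong_trans x y z : mcong x y -> mcong y z -> mcong x z
| mcong_add x x' y y' :
    mcong x x' -> mcong y y' -> mcong (Madd x y) (Madd x' y')
| mcong_opp x x' : mcong x x' -> mcong (Mopp x) (Mopp x')
| mcong_scale a x x' : mcong x x' -> mcong (Mscale a x) (Mscale a x')
| mcong_addA x y z : mcong (Madd x (Madd y z)) (Madd (Madd x y) z)
| mcong_addC x y : mcong (Madd x y) (Madd y x)
| mcong_add0 x : mcong (Madd Mzero x) x
| mcong_addN x : mcong (Madd (Mopp x) x) Mzero
| mcong_scaleA a b x : mcong (Mscale a (Mscale b x)) (Mscale (a * b) x)
| mcong_scale1 x : mcong (Mscale 1 x) x
| mcong_scaleDr a x y :
    mcong (Mscale a (Madd x y)) (Madd (Mscale a x) (Mscale a y))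
| mcong_scaleDl a b x :
    mcong (Mscale (a + b) x) (Madd (Mscale a x) (Mscale b x)).

HB.instance Definition _ := gen_eqMixin mterm.
HB.instance Definition _ := gen_choiceMixin mterm.

Definition mcongb : rel mterm := fun x y => `[< mcong x y >].

Lemma mcongb_equiv : equiv_class_of mcongb.
Proof.
split=> [x|x y|y x z].
- exact/asboolP/mcong_refl.
- by apply/asboolP/asboolP => /mcong_sym.
- by move=> /asboolP xy /asboolP yz; exact/asboolP/(mcong_trans xy yz).
Qed.

Canonical mcongb_equiv_rel := EquivRelPack mcongb_equiv.

Definition pmod := {eq_quot mcongb}.
HB.instance Definition _ := Choice.on pmod.

Definition mpi (x : mterm) : pmod := \pi_pmod x.

Lemma mpiP x y : mpi x = mpi y <-> mcong x y.
Proof. by split=> [/eqmodP/asboolP|xy] //; exact/eqmodP/asboolP. Qed.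

Lemma mrepr x : mcong (repr (mpi x)) x.
Proof. by apply/mpiP; rewrite /mpi reprK. Qed.

Lemma mpiW (P : pmod -> Prop) : (forall x, P (mpi x)) -> forall x, P x.
Proof. by move=> H x; rewrite -[x]reprK; exact: H. Qed.

Definition pm_add (x y : pmod) := mpi (Madd (repr x) (repr y)).
Definition pm_opp (x : pmod) := mpi (Mopp (repr x)).
Definition pm_scale (a : R) (x : pmod) := mpi (Mscale a (repr x)).

Lemma pm_addE x y : pm_add (mpi x) (mpi y) = mpi (Madd x y).
Proof. by apply/mpiP; apply: mcong_add; exact: mrepr. Qed.
Lemma pm_oppE x : pm_opp (mpi x) = mpi (Mopp x).
Proof. by apply/mpiP; apply: mcong_opp; exact: mrepr. Qed.
Lemma pm_scaleE a x : pm_scale a (mpi x) = mpi (Mscale a x).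
Proof. by apply/mpiP; apply: mcong_scale; exact: mrepr. Qed.

Lemma pm_addA : associative pm_add.
Proof.
elim/mpiW=> x; elim/mpiW=> y; elim/mpiW=> z; rewrite !pm_addE.
exact/mpiP/mcong_addA.
Qed.
Lemma pm_addC : commutative pm_add.
Proof. by elim/mpiW=> x; elim/mpiW=> y; rewrite !pm_addE; exact/mpiP/mcong_addC. Qed.
Lemma pm_add0 : left_id (mpi Mzero) pm_add.
Proof. by elim/mpiW=> x; rewrite pm_addE; exact/mpiP/mcong_add0. Qed.
Lemma pm_addN : left_inverse (mpi Mzero) pm_opp pm_add.
Proof. by elim/mpiW=> x; rewrite pm_oppE pm_addE; exact/mpiP/mcong_addN. Qed.

HB.instance Definition _ :=
  GRing.isZmodule.Build pmod pm_addA pm_addC pm_add0 pm_addN.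

Lemma pm_scaleA a b (x : pmod) :
  pm_scale a (pm_scale b x) = pm_scale (a * b) x.
Proof. by elim/mpiW: x => x; rewrite !pm_scaleE; exact/mpiP/mcong_scaleA. Qed.
Lemma pm_scale1 : left_id 1 pm_scale.
Proof. by elim/mpiW=> x; rewrite !pm_scaleE; exact/mpiP/mcong_scale1. Qed.
Lemma pm_scaleDr : right_distributive pm_scale +%R.
Proof.
move=> a; elim/mpiW=> x; elim/mpiW=> y.
rewrite {1}[mpi x + mpi y]pm_addE !pm_scaleE [RHS]pm_addE.
exact/mpiP/mcong_scaleDr.
Qed.
Lemma pm_scaleDl (x : pmod) : {morph pm_scale^~ x : a b / a + b}.
Proof.
move=> a b; elim/mpiW: x => x; rewrite !pm_scaleE [RHS]pm_addE.
exact/mpiP/mcong_scaleDl.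
Qed.

HB.instance Definition _ := GRing.Zmodule_isLmodule.Build R pmod
  pm_scaleA pm_scale1 pm_scaleDr pm_scaleDl.

Definition pm_gen (g : G) : pmod := mpi (Mgen g).
End PresentedModule.
Arguments Mzero {R G}.

(* The symmetric algebra of M: the commutative R-algebra generated by the    *)
(* elements of M subject to the R-linear relations holding in M.             *)
Section SymmetricAlgebra.
Variables (R : comPzRingType) (M : lmodType R).

Inductive sterm :=
| Sconst of R
| Sgen of M
| Sadd of sterm & sterm
| Sopp of sterm
| Smul of sterm & sterm.

Inductive scong : sterm -> sterm -> Prop :=
| scong_genD m n : scong (Sgen (m + n)) (Sadd (Sgen m) (Sgen n))
| scong_genZ a m : scong (Sgen (a *: m)) (Smul (Sconst a) (Sgen m))
| scong_constD a b : scong (Sconst (a + b)) (Sadd (Sconst a) (Sconst b))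
| scong_constM a b : scong (Sconst (a * b)) (Smul (Sconst a) (Sconst b))
| scong_refl x : scong x x
| scong_sym x y : scong x y -> scong y x
| scong_trans x y z : scong x y -> scong y z -> scong x z
| scong_add x x' y y' :
    scong x x' -> scong y y' -> scong (Sadd x y) (Sadd x' y')
| scong_opp x x' : scong x x' -> scong (Sopp x) (Sopp x')
| scong_mul x x' y y' :
    scong x x' -> scong y y' -> scong (Smul x y) (Smul x' y')
| scong_addA x y z : scong (Sadd x (Sadd y z)) (Sadd (Sadd x y) z)
| scong_addC x y : scong (Sadd x y) (Sadd y x)
| scong_add0 x : scong (Sadd (Sconst 0) x) x
| scong_addN x : scong (Sadd (Sopp x) x) (Sconst 0)
| scong_mulA x y z : scong (Smul x (Smul y z)) (Smul (Smul x y) z)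
| scong_mulC x y : scong (Smul x y) (Smul y x)
| scong_mul1 x : scong (Smul (Sconst 1) x) x
| scong_mulDl x y z :
    scong (Smul (Sadd x y) z) (Sadd (Smul x z) (Smul y z)).

HB.instance Definition _ := gen_eqMixin sterm.
HB.instance Definition _ := gen_choiceMixin sterm.

Definition scongb : rel sterm := fun x y => `[< scong x y >].

Lemma scongb_equiv : equiv_class_of scongb.
Proof.
split=> [x|x y|y x z].
- exact/asboolP/scong_refl.
- by apply/asboolP/asboolP => /scong_sym.
- by move=> /asboolP xy /asboolP yz; exact/asboolP/(scong_trans xy yz).
Qed.

Canonical scongb_equiv_rel := EquivRelPack scongb_equiv.

Definition Sym := {eq_quot scongb}.
HB.instance Definition _ := Choice.on Sym.

Definition spi (x : sterm) : Sym := \pi_Sym x.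

Lemma spiP x y : spi x = spi y <-> scong x y.
Proof. by split=> [/eqmodP/asboolP|xy] //; exact/eqmodP/asboolP. Qed.

Lemma srepr x : scong (repr (spi x)) x.
Proof. by apply/spiP; rewrite /spi reprK. Qed.

Lemma spiW (P : Sym -> Prop) : (forall x, P (spi x)) -> forall x, P x.
Proof. by move=> H x; rewrite -[x]reprK; exact: H. Qed.

Definition sym_add (x y : Sym) := spi (Sadd (repr x) (repr y)).
Definition sym_opp (x : Sym) := spi (Sopp (repr x)).
Definition sym_mul (x y : Sym) := spi (Smul (repr x) (repr y)).

Lemma sym_addE x y : sym_add (spi x) (spi y) = spi (Sadd x y).
Proof. by apply/spiP; apply: scong_add; exact: srepr. Qed.
Lemma sym_oppE x : sym_opp (spi x) = spi (Sopp x).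
Proof. by apply/spiP; apply: scong_opp; exact: srepr. Qed.
Lemma sym_mulE x y : sym_mul (spi x) (spi y) = spi (Smul x y).
Proof. by apply/spiP; apply: scong_mul; exact: srepr. Qed.

Lemma sym_addA : associative sym_add.
Proof.
elim/spiW=> x; elim/spiW=> y; elim/spiW=> z; rewrite !sym_addE.
exact/spiP/scong_addA.
Qed.
Lemma sym_addC : commutative sym_add.
Proof. by elim/spiW=> x; elim/spiW=> y; rewrite !sym_addE; exact/spiP/scong_addC. Qed.
Lemma sym_add0 : left_id (spi (Sconst 0)) sym_add.
Proof. by elim/spiW=> x; rewrite sym_addE; exact/spiP/scong_add0. Qed.
Lemma sym_addN : left_inverse (spi (Sconst 0)) sym_opp sym_add.
Proof. by elim/spiW=> x; rewrite sym_oppE sym_addE; exact/spiP/scong_addN. Qed.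

HB.instance Definition _ :=
  GRing.isZmodule.Build Sym sym_addA sym_addC sym_add0 sym_addN.

Lemma sym_mulA : associative sym_mul.
Proof.
elim/spiW=> x; elim/spiW=> y; elim/spiW=> z; rewrite !sym_mulE.
exact/spiP/scong_mulA.
Qed.
Lemma sym_mulC : commutative sym_mul.
Proof. by elim/spiW=> x; elim/spiW=> y; rewrite !sym_mulE; exact/spiP/scong_mulC. Qed.
Lemma sym_mul1 : left_id (spi (Sconst 1)) sym_mul.
Proof. by elim/spiW=> x; rewrite sym_mulE; exact/spiP/scong_mul1. Qed.
Lemma sym_mulDl : left_distributive sym_mul +%R.
Proof.
elim/spiW=> x; elim/spiW=> y; elim/spiW=> z.
rewrite {1}[spi x + spi y]sym_addE !sym_mulE [RHS]sym_addE.
exact/spiP/scong_mulDl.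
Qed.

HB.instance Definition _ := GRing.Zmodule_isComPzRing.Build Sym
  sym_mulA sym_mulC sym_mul1 sym_mulDl.

Definition sym_const (a : R) : Sym := spi (Sconst a).
Definition sym_gen (m : M) : Sym := spi (Sgen m).

Lemma sym_const_zmod_morphism : zmod_morphism sym_const.
Proof.
have D : {morph sym_const : a b / a + b}.
  by move=> a b; rewrite [RHS]sym_addE; exact/spiP/scong_constD.
by move=> a b; apply/eqP; rewrite eq_sym subr_eq -D subrK.
Qed.
Lemma sym_const_monoid_morphism : monoid_morphism sym_const.
Proof. by split=> // a b; rewrite [RHS]sym_mulE; exact/spiP/scong_constM. Qed.

HB.instance Definition _ :=
  GRing.isZmodMorphism.Build R Sym sym_const sym_const_zmod_morphism.
HB.instance Definition _ :=
  GRing.isMonoidMorphism.Build R Sym sym_const sym_const_monoid_morphism.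
End SymmetricAlgebra.

(* The quotient of the ring S by the ideal generated by E.                   *)
(* (ring_quotient only provides quotients that are nonzero rings.)           *)
Section QuotientRing.
Variables (S : comPzRingType) (E : set S).

Inductive ideal_gen : set S :=
| ideal_gen_in x : E x -> ideal_gen x
| ideal_gen0 : ideal_gen 0
| ideal_genD x y : ideal_gen x -> ideal_gen y -> ideal_gen (x + y)
| ideal_genM a x : ideal_gen x -> ideal_gen (a * x).

Definition qcongb : rel S := fun x y => `[< ideal_gen (x - y) >].

Lemma qcongb_equiv : equiv_class_of qcongb.
Proof.
have sym x y : ideal_gen (x - y) -> ideal_gen (y - x).
  by move=> xy; rewrite -opprB -mulN1r; exact: ideal_genM.
split=> [x|x y|y x z].
- by apply/asboolP; rewrite subrr; exact: ideal_gen0.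
- by apply/asboolP/asboolP; exact: sym.
- move=> /asboolP xy /asboolP yz; apply/asboolP.
  by rewrite -[x](subrK y) -addrA; exact: ideal_genD.
Qed.

Canonical qcongb_equiv_rel := EquivRelPack qcongb_equiv.

Definition qring := {eq_quot qcongb}.
HB.instance Definition _ := Choice.on qring.

Definition qpi (x : S) : qring := \pi_qring x.

Lemma qpiP x y : qpi x = qpi y <-> ideal_gen (x - y).
Proof. by split=> [/eqmodP/asboolP|xy] //; exact/eqmodP/asboolP. Qed.

Lemma qrepr x : ideal_gen (repr (qpi x) - x).
Proof. by apply/qpiP; rewrite /qpi reprK. Qed.

Lemma qpiW (P : qring -> Prop) : (forall x, P (qpi x)) -> forall x, P x.
Proof. by move=> H x; rewrite -[x]reprK; exact: H. Qed.

Definition q_add (x y : qring) := qpi (repr x + repr y).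
Definition q_opp (x : qring) := qpi (- repr x).
Definition q_mul (x y : qring) := qpi (repr x * repr y).

Lemma q_addE x y : q_add (qpi x) (qpi y) = qpi (x + y).
Proof.
by apply/qpiP; rewrite opprD addrACA; apply: ideal_genD; exact: qrepr.
Qed.
Lemma q_oppE x : q_opp (qpi x) = qpi (- x).
Proof. by apply/qpiP; rewrite -opprD -mulN1r; exact/ideal_genM/qrepr. Qed.
Lemma q_mulE x y : q_mul (qpi x) (qpi y) = qpi (x * y).
Proof.
apply/qpiP; set x' := repr _; set y' := repr _.
have -> : x' * y' - x * y = y' * (x' - x) + x * (y' - y).
  by rewrite !mulrBr (mulrC y' x') (mulrC y' x) addrA subrK.
by apply: ideal_genD; apply: ideal_genM; exact: qrepr.
Qed.

Lemma q_addA : associative q_add.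
Proof. by elim/qpiW=> x; elim/qpiW=> y; elim/qpiW=> z; rewrite !q_addE addrA. Qed.
Lemma q_addC : commutative q_add.
Proof. by elim/qpiW=> x; elim/qpiW=> y; rewrite !q_addE addrC. Qed.
Lemma q_add0 : left_id (qpi 0) q_add.
Proof. by elim/qpiW=> x; rewrite q_addE add0r. Qed.
Lemma q_addN : left_inverse (qpi 0) q_opp q_add.
Proof. by elim/qpiW=> x; rewrite q_oppE q_addE addNr. Qed.

HB.instance Definition _ :=
  GRing.isZmodule.Build qring q_addA q_addC q_add0 q_addN.

Lemma q_mulA : associative q_mul.
Proof. by elim/qpiW=> x; elim/qpiW=> y; elim/qpiW=> z; rewrite !q_mulE mulrA. Qed.
Lemma q_mulC : commutative q_mul.
Proof. by elim/qpiW=> x; elim/qpiW=> y; rewrite !q_mulE mulrC. Qed.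
Lemma q_mul1 : left_id (qpi 1) q_mul.
Proof. by elim/qpiW=> x; rewrite q_mulE mul1r. Qed.
Lemma q_mulDl : left_distributive q_mul +%R.
Proof.
elim/qpiW=> x; elim/qpiW=> y; elim/qpiW=> z.
by rewrite {1}[qpi x + qpi y]q_addE !q_mulE [RHS]q_addE mulrDl.
Qed.

HB.instance Definition _ := GRing.Zmodule_isComPzRing.Build qring
  q_mulA q_mulC q_mul1 q_mulDl.

Lemma qpi_zmod_morphism : zmod_morphism qpi.
Proof.
have D : {morph qpi : a b / a + b} by move=> a b; rewrite [RHS]q_addE.
by move=> a b; apply/eqP; rewrite eq_sym subr_eq -D subrK.
Qed.
Lemma qpi_monoid_morphism : monoid_morphism qpi.
Proof. by split=> // a b; rewrite [RHS]q_mulE. Qed.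

HB.instance Definition _ :=
  GRing.isZmodMorphism.Build S qring qpi qpi_zmod_morphism.
HB.instance Definition _ :=
  GRing.isMonoidMorphism.Build S qring qpi qpi_monoid_morphism.
End QuotientRing.

Definition is_derivation (K : pzRingType) (delta : K -> K) :=
  (forall a b, delta (a + b) = delta a + delta b) /\
  (forall a b, delta (a * b) = a * delta b + b * delta a).

Section Kahler.
Variable R : comPzRingType.
Let d (r : R) : mterm R R := Mgen R r.

Inductive Kahler_rel : mterm R R -> mterm R R -> Prop :=
| Kahler_add r s : Kahler_rel (d (r + s)) (Madd (d r) (d s))
| Kahler_mul r s :
    Kahler_rel (d (r * s)) (Madd (Mscale r (d s)) (Mscale s (d r))).

Definition Omega : lmodType R := pmod Kahler_rel.
Definition Omega_d (r : R) : Omega := pm_gen Kahler_rel r.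
End Kahler.

(* A K-algebra is given by a ring R and its structure map k : K -> R.        *)
Section TauDifferentials.
Variables (K : fieldType) (delta : K -> K).
Variables (R : comPzRingType) (k : {rmorphism K -> R}).
Let tau (r : R) : mterm R R := Mgen R r.

Inductive tau_rel : mterm R R -> mterm R R -> Prop :=
| tau_add r s : tau_rel (tau (r + s)) (Madd (tau r) (tau s))
| tau_mul r s :
    tau_rel (tau (r * s)) (Madd (Mscale r (tau s)) (Mscale s (tau r)))
| tau_delta a b :
    tau_rel (Mscale (k (delta a)) (tau (k b)))
            (Mscale (k (delta b)) (tau (k a))).

Definition Omega_tau : lmodType R := pmod tau_rel.
Definition Omega_tau_gen (r : R) : Omega_tau := pm_gen tau_rel r.
End TauDifferentials.

(* The data, for every K-algebra R, of an R-algebra with elements d r for    *)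
(* r : R. In the two cases below it is generated as a ring by the images of  *)
(* dalg_const and dalg_d, hence a ring morphism out of it is determined by   *)
(* its values on these; in particular the map induced by a morphism          *)
(* f : R -> R' of K-algebras is the one sending r to f r and d r to d (f r). *)
Record dalg (K : fieldType) := Dalg {
  dalg_ring :> forall R : comPzRingType, {rmorphism K -> R} -> comPzRingType;
  dalg_const : forall (R : comPzRingType) (k : {rmorphism K -> R}),
    {rmorphism R -> dalg_ring k};
  dalg_d : forall (R : comPzRingType) (k : {rmorphism K -> R}),
    R -> dalg_ring k }.

Section ProlongationAlgebras.
Variables (K : fieldType) (delta : K -> K).

Section Prolongation.
Variables (R : comPzRingType) (k : {rmorphism K -> R}).

Definition prolong_ideal : set (Sym (Omega R)) :=
  [set x | exists a : K,
    x = sym_gen (Omega_d (k a)) - sym_const (Omega R) (k (delta a))].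

Definition prolong_ring : comPzRingType := qring prolong_ideal.

Definition prolong_const : {rmorphism R -> prolong_ring} :=
  @qpi _ prolong_ideal \o @sym_const R (Omega R).

Definition prolong_d (r : R) : prolong_ring :=
  qpi prolong_ideal (sym_gen (Omega_d r)).
End Prolongation.

Definition prolong_alg : dalg K := Dalg prolong_const prolong_d.

Definition cone_alg : dalg K :=
  @Dalg K (fun (R : comPzRingType) (k : {rmorphism K -> R}) =>
      Sym (Omega_tau delta k))
    (fun R k => @sym_const R (Omega_tau delta k))
    (fun R k r => sym_gen (Omega_tau_gen delta k r)).
End ProlongationAlgebras.

Record variety (K : fieldType) := Variety {
  vscheme :> scheme;
  vstruct : mor vscheme (Spec_field K);
  variety_integral : integral_scheme vscheme;
  variety_separated : separated vstruct;
  variety_finite_type : finite_type vstruct }.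

Definition over_K (K : fieldType) (X Y : variety K) (f : mor X Y) :=
  mor_eq (comp_mor (vstruct Y) f) (vstruct X).

Lemma kmap_sub (K : fieldType) (X : variety K) (U : opens X) :
  U `<=` pre (vstruct X) (openT _).
Proof. by []. Qed.

Definition kmap (K : fieldType) (X : variety K) (U : opens X) :
    {rmorphism K -> sect X U} :=
  pull (@kmap_sub K X U) \o @const_sectm K.

(* The relative spectrum over X of the quasi-coherent sheaf of algebras with *)
(* sections A(O_X(V)) on affine open V: an X-scheme whose restriction over   *)
(* each affine open V is identified with Spec A(O_X(V)), as a scheme over V, *)
(* compatibly with the restrictions A(O_X(V)) -> A(O_X(W)). This determines  *)
(* it up to a unique isomorphism over X.                                     *)
Record rel_Spec (K : fieldType) (A : dalg K) (X : variety K) := RelSpec {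
  total :> scheme;
  proj : mor total X;
  chart : forall V : opens X, affine_open V ->
    {rmorphism A _ (kmap V) -> sect total (pre proj V)};
  chart_Spec : forall (V : opens X) (hV : affine_open V), is_Spec (chart hV);
  chart_const : forall (V : opens X) (hV : affine_open V) (r : sect X V),
    chart hV (dalg_const A (kmap V) r) = comor proj V r;
  chart_d : forall (V W : opens X) (hV : affine_open V) (hW : affine_open W)
    (h : W `<=` V) (h' : pre proj W `<=` pre proj V) (r : sect X V),
    res h' (chart hV (dalg_d A (kmap V) r)) =
    chart hW (dalg_d A (kmap W) (res h r)) }.

(* g : Spec A_X -> Spec A_Y is the morphism induced by f : X -> Y: it lies   *)
(* over f and pulls d r back to d (f^* r).                                   *)
Definition induced (K : fieldType) (A : dalg K) (X Y : variety K)
    (f : mor X Y) (P : rel_Spec A X) (Q : rel_Spec A Y) (g : mor P Q) :=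
  mor_eq (comp_mor (proj Q) g) (comp_mor f (proj P)) /\
  forall (V : opens X) (W : opens Y) (hV : affine_open V) (hW : affine_open W)
    (h : V `<=` pre f W) (h' : pre (proj P) V `<=` pre g (pre (proj Q) W))
    (r : sect Y W),
    pull h' (chart Q hW (dalg_d A (kmap W) r)) =
    chart P hV (dalg_d A (kmap V) (pull h r)).

Definition prolongation (K : fieldType) (delta : K -> K) (X : variety K) :=
  rel_Spec (prolong_alg delta) X.

Definition prolongation_cone (K : fieldType) (delta : K -> K) (X : variety K) :=
  rel_Spec (cone_alg delta) X.

(* Main.v *)
From HB Require Import structures.
From mathcomp Require Import all_boot all_algebra.
From mathcomp Require Import generic_quotient.
From mathcomp Require Import boolp classical_sets topology_structure.
Require Import Defs.

(** Over an affine open [Spec R] of [X] both schemes are affine: the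
prolongation is the spectrum of the [R]-algebra generated by symbols [d r]
subject to the rules of a derivation and to [d a = delta a] for scalars [a], and
the cone is the spectrum of the [R]-algebra generated by symbols [tau r]
subject to the rules of a derivation and to
[delta a * tau b = delta b * tau a].  In the former algebra
[delta a * d b = delta a * delta b = delta b * d a], so [tau r |-> d r] defines
a ring morphism ([cone_to_prolong]) that is onto since the [d r] generate.  A
surjection of rings is a closed embedding of spectra, and since the formula
[tau r |-> d r] makes no choice, the embeddings over the affine opens are
compatible with restriction and with the morphisms induced by [X -> Y].

The rest is the passage from rings to schemes.  A morphism of locally ringed
spaces amounts to a continuous map with local morphisms on stalks that
locally come from sections ([stalk_mor]).  As the stalk of [Spec B] at a
point consists of fractions of elements of [B], a ring morphism
[B -> O_T(W)] provides both the map on points and the map on stalks, and these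
agree for two charts that have common refinements ([glue_charts]); for the
same reason a morphism into [Spec B] is determined by its effect on [B]
([mor_eq_local]).  Common refinements exist because the affine opens form a
base of a scheme ([affine_base]).  Being a closed immersion is checked on
the charts of the target ([closed_immersion_charts]).  Finally, two
morphisms into a relative spectrum over [X] are compared on the generators
[r] and [tau r], which gives both that the embedding lies over [X] and that it
is natural. *)

Set Implicit Arguments.
Unset Strict Implicit.
Unset Printing Implicit Defensive.

Import GRing.Theory.
Local Open Scope classical_set_scope.
Local Open Scope ring_scope.
Local Open Scope quotient_scope.

(** * Invertible elements and open sets *)

Section Invertible.
Variable A : comPzRingType.

Lemma invertible1 : invertible (1 : A).
Proof. by exists 1; rewrite mulr1. Qed.

Lemma invertibleM (a b : A) : invertible (a * b) <-> invertible a /\ invertible b.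
Proof.
split=> [[c abc]|[[c ac] [d bd]]].
  by split; [exists (b * c)|exists (a * c)]; rewrite mulrA // (mulrC b).
by exists (c * d); rewrite mulrACA ac bd mulr1.
Qed.

Lemma invertibleX (a : A) n : invertible a -> invertible (a ^+ n).
Proof.
by move=> ia; elim: n => [|n IH]; rewrite ?expr0 ?exprS;
  [exact: invertible1|exact/invertibleM].
Qed.

Lemma invertible_inj (a b c : A) : invertible a -> b * a = c * a -> b = c.
Proof.
by move=> [d ad] /(congr1 ( *%R^~ d)); rewrite -!mulrA ad !mulr1.
Qed.

Lemma invertible_morph (B : comPzRingType) (f : {rmorphism A -> B}) a :
  invertible a -> invertible (f a).
Proof. by move=> [b ab]; exists (f b); rewrite -rmorphM ab rmorph1. Qed.
End Invertible.

Section Meet.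
Variable T : topologicalType.
Implicit Types U V W : opens T.

Definition meet U V : opens T := Opens (openI (@oset_open T U) (@oset_open T V)).

Lemma meetl U V : meet U V `<=` U. Proof. by move=> x []. Qed.
Lemma meetr U V : meet U V `<=` V. Proof. by move=> x []. Qed.
End Meet.

Lemma res_irr (X : ringed_space) (U V : opens X) (h h' : V `<=` U) s :
  res h s = res h' s.
Proof. by rewrite (Prop_irrelevance h h'). Qed.

(** * Stalks *)

Section Stalk.
Variables (X : ringed_space) (x : X).

Record nbsect := NbSect {
  nb_open : opens X;
  nb_mem : nb_open x;
  nb_val : sect X nb_open }.

HB.instance Definition _ := gen_eqMixin nbsect.
HB.instance Definition _ := gen_choiceMixin nbsect.

Definition same_germ (U V : opens X) (s : sect X U) (t : sect X V) :=
  exists (W : opens X) (h : W `<=` U) (h' : W `<=` V), W x /\ res h s = res h' t.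

Lemma same_germ_trans U V W (s : sect X U) (t : sect X V) (u : sect X W) :
  same_germ s t -> same_germ t u -> same_germ s u.
Proof.
move=> [W1 [h1 [h1' [W1x e1]]]] [W2 [h2 [h2' [W2x e2]]]].
exists (meet W1 W2), (subset_trans (@meetl _ _ _) h1),
  (subset_trans (@meetr _ _ _) h2'); split=> //.
rewrite -(res_comp h1 (@meetl _ _ _)) e1 -(res_comp h2' (@meetr _ _ _)) -e2.
by rewrite !(res_comp _ _ (subset_trans (@meetl _ _ _) h1')).
Qed.

Definition nb_rel : rel nbsect :=
  fun s t => `[< same_germ (nb_val s) (nb_val t) >].

Lemma nb_rel_equiv : equiv_class_of nb_rel.
Proof.
split=> [s|s t|t s u].
- by apply/asboolP; exists (nb_open s), (fun=> id), (fun=> id); split=> //; exact: nb_mem.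
- by apply/asboolP/asboolP => -[W [h [h' [Wx e]]]]; exists W, h', h.
- by move=> /asboolP st /asboolP tu; apply/asboolP; exact: same_germ_trans tu.
Qed.

Canonical nb_rel_equiv_rel := EquivRelPack nb_rel_equiv.

Definition stalk := {eq_quot nb_rel}.
HB.instance Definition _ := Choice.on stalk.

Definition germ_of (U : opens X) (Ux : U x) (s : sect X U) : stalk :=
  \pi_stalk (NbSect Ux s).

Lemma germ_ofP (U V : opens X) (Ux : U x) (Vx : V x) (s : sect X U) (t : sect X V) :
  germ_of Ux s = germ_of Vx t <-> same_germ s t.
Proof. by split=> [/eqmodP/asboolP|st] //; exact/eqmodP/asboolP. Qed.

Lemma germ_of_res (U V : opens X) (Ux : U x) (Vx : V x) (h : V `<=` U) s :
  germ_of Vx (res h s) = germ_of Ux s.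
Proof.
by apply/germ_ofP; exists V, (fun=> id), h; split; rewrite ?res_id.
Qed.

Lemma germ_of_surj (z : stalk) : exists (U : opens X) (Ux : U x) s, z = germ_of Ux s.
Proof.
exists (nb_open (repr z)), (nb_mem (repr z)), (nb_val (repr z)).
by rewrite /germ_of; case: (repr z) (reprK z).
Qed.

(** Finitely many germs live on a common neighbourhood, so the ring axioms of
the stalk are those of the sections over it. *)
Lemma germ_of_surj3 (z1 z2 z3 : stalk) : exists (U : opens X) (Ux : U x) s1 s2 s3,
  [/\ z1 = germ_of Ux s1, z2 = germ_of Ux s2 & z3 = germ_of Ux s3].
Proof.
have [U1 [U1x [s1 ->]]] := germ_of_surj z1.
have [U2 [U2x [s2 ->]]] := germ_of_surj z2.
have [U3 [U3x [s3 ->]]] := germ_of_surj z3.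
pose U := meet U1 (meet U2 U3).
have Ux : U x by [].
have h1 : U `<=` U1 by move=> y [].
have h2 : U `<=` U2 by move=> y [_ []].
have h3 : U `<=` U3 by move=> y [_ []].
by exists U, Ux, (res h1 s1), (res h2 s2), (res h3 s3); rewrite !germ_of_res.
Qed.

Definition nb_add (s t : nbsect) : nbsect :=
  NbSect (conj (nb_mem s) (nb_mem t) : meet (nb_open s) (nb_open t) x)
    (res (@meetl _ _ _) (nb_val s) + res (@meetr _ _ _) (nb_val t)).
Definition nb_mul (s t : nbsect) : nbsect :=
  NbSect (conj (nb_mem s) (nb_mem t) : meet (nb_open s) (nb_open t) x)
    (res (@meetl _ _ _) (nb_val s) * res (@meetr _ _ _) (nb_val t)).
Definition nb_opp (s : nbsect) : nbsect := NbSect (nb_mem s) (- nb_val s).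

Definition st_add (z w : stalk) : stalk := \pi_stalk (nb_add (repr z) (repr w)).
Definition st_mul (z w : stalk) : stalk := \pi_stalk (nb_mul (repr z) (repr w)).
Definition st_opp (z : stalk) : stalk := \pi_stalk (nb_opp (repr z)).

Lemma germ_of_repr (U : opens X) (Ux : U x) s :
  same_germ (nb_val (repr (germ_of Ux s))) s.
Proof.
apply/(germ_ofP (nb_mem _) Ux); rewrite -[RHS]reprK /germ_of.
by case: (repr _).
Qed.

Lemma same_germ2 U1 V1 U2 V2 (s1 : sect X U1) (t1 : sect X V1)
    (s2 : sect X U2) (t2 : sect X V2) :
  same_germ s1 t1 -> same_germ s2 t2 ->
  exists (W : opens X) (h1 : W `<=` U1) (k1 : W `<=` V1)
      (h2 : W `<=` U2) (k2 : W `<=` V2),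
    [/\ W x, res h1 s1 = res k1 t1 & res h2 s2 = res k2 t2].
Proof.
move=> [W1 [h1 [k1 [W1x e1]]]] [W2 [h2 [k2 [W2x e2]]]].
have l : meet W1 W2 `<=` W1 := @meetl _ _ _.
have r : meet W1 W2 `<=` W2 := @meetr _ _ _.
exists (meet W1 W2), (subset_trans l h1), (subset_trans l k1),
  (subset_trans r h2), (subset_trans r k2); split=> //.
  by rewrite -(res_comp h1 l) -(res_comp k1 l) e1.
by rewrite -(res_comp h2 r) -(res_comp k2 r) e2.
Qed.

Lemma st_addE (U : opens X) (Ux : U x) s t :
  st_add (germ_of Ux s) (germ_of Ux t) = germ_of Ux (s + t).
Proof.
apply/germ_ofP.
have [W [h1 [k1 [h2 [k2 [Wx e1 e2]]]]]] :=
  same_germ2 (germ_of_repr Ux s) (germ_of_repr Ux t).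
exists W, (fun y Wy => conj (h1 y Wy) (h2 y Wy)), k1; split=> //.
rewrite !rmorphD /= (res_comp _ _ h1) (res_comp _ _ h2) e1 e2.
by rewrite (res_irr k2 k1).
Qed.

Lemma st_mulE (U : opens X) (Ux : U x) s t :
  st_mul (germ_of Ux s) (germ_of Ux t) = germ_of Ux (s * t).
Proof.
apply/germ_ofP.
have [W [h1 [k1 [h2 [k2 [Wx e1 e2]]]]]] :=
  same_germ2 (germ_of_repr Ux s) (germ_of_repr Ux t).
exists W, (fun y Wy => conj (h1 y Wy) (h2 y Wy)), k1; split=> //.
rewrite !rmorphM /= (res_comp _ _ h1) (res_comp _ _ h2) e1 e2.
by rewrite (res_irr k2 k1).
Qed.

Lemma st_oppE (U : opens X) (Ux : U x) s : st_opp (germ_of Ux s) = germ_of Ux (- s).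
Proof.
apply/germ_ofP; have [W [h [k [Wx e]]]] := germ_of_repr Ux s.
by exists W, h, k; split=> //; rewrite !rmorphN e.
Qed.

Definition st_zero : stalk := germ_of (I : openT X x) 0.
Definition st_one : stalk := germ_of (I : openT X x) 1.

Lemma st_zeroE (U : opens X) (Ux : U x) : st_zero = germ_of Ux 0.
Proof.
have h : U `<=` openT X by [].
by rewrite /st_zero /st_one -(germ_of_res (I : openT X x) Ux h) rmorph0.
Qed.
Lemma st_oneE (U : opens X) (Ux : U x) : st_one = germ_of Ux 1.
Proof.
have h : U `<=` openT X by [].
by rewrite /st_zero /st_one -(germ_of_res (I : openT X x) Ux h) rmorph1.
Qed.

Lemma st_addA : associative st_add.
Proof.
move=> z1 z2 z3; have [U [Ux [s1 [s2 [s3 [-> -> ->]]]]]] := germ_of_surj3 z1 z2 z3.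
by rewrite !st_addE addrA.
Qed.
Lemma st_addC : commutative st_add.
Proof.
move=> z1 z2; have [U [Ux [s1 [s2 [s3 [-> -> _]]]]]] := germ_of_surj3 z1 z2 z2.
by rewrite !st_addE addrC.
Qed.
Lemma st_add0 : left_id st_zero st_add.
Proof.
by move=> z; have [U [Ux [s ->]]] := germ_of_surj z; rewrite (st_zeroE Ux) st_addE add0r.
Qed.
Lemma st_addN : left_inverse st_zero st_opp st_add.
Proof.
move=> z; have [U [Ux [s ->]]] := germ_of_surj z.
by rewrite st_oppE st_addE addNr (st_zeroE Ux).
Qed.

HB.instance Definition _ :=
  GRing.isZmodule.Build stalk st_addA st_addC st_add0 st_addN.

Lemma st_mulA : associative st_mul.
Proof.
move=> z1 z2 z3; have [U [Ux [s1 [s2 [s3 [-> -> ->]]]]]] := germ_of_surj3 z1 z2 z3.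
by rewrite !st_mulE mulrA.
Qed.
Lemma st_mulC : commutative st_mul.
Proof.
move=> z1 z2; have [U [Ux [s1 [s2 [s3 [-> -> _]]]]]] := germ_of_surj3 z1 z2 z2.
by rewrite !st_mulE mulrC.
Qed.
Lemma st_mul1 : left_id st_one st_mul.
Proof.
by move=> z; have [U [Ux [s ->]]] := germ_of_surj z; rewrite (st_oneE Ux) st_mulE mul1r.
Qed.
Lemma st_mulDl : left_distributive st_mul +%R.
Proof.
move=> z1 z2 z3; have [U [Ux [s1 [s2 [s3 [-> -> ->]]]]]] := germ_of_surj3 z1 z2 z3.
rewrite {1}[germ_of Ux s1 + _]st_addE !st_mulE [RHS]st_addE.
by rewrite mulrDl.
Qed.

HB.instance Definition _ := GRing.Zmodule_isComPzRing.Build stalk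
  st_mulA st_mulC st_mul1 st_mulDl.

Section Germ.
Variables (U : opens X) (Ux : U x).

Lemma germ_of_zmod_morphism : zmod_morphism (germ_of Ux).
Proof. by move=> s t; rewrite -[RHS]/(st_add _ (st_opp _)) st_oppE st_addE. Qed.
Lemma germ_of_monoid_morphism : monoid_morphism (germ_of Ux).
Proof. by split=> [|s t]; [rewrite -[RHS]/st_one (st_oneE Ux)|rewrite [RHS]st_mulE]. Qed.

HB.instance Definition _ :=
  GRing.isZmodMorphism.Build _ _ (germ_of Ux) germ_of_zmod_morphism.
HB.instance Definition _ :=
  GRing.isMonoidMorphism.Build _ _ (germ_of Ux) germ_of_monoid_morphism.

Definition germ : {rmorphism sect X U -> stalk} := germ_of Ux.
End Germ.

Lemma germP (U V : opens X) (Ux : U x) (Vx : V x) (s : sect X U) (t : sect X V) :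
  germ Ux s = germ Vx t <-> same_germ s t.
Proof. exact: germ_ofP. Qed.

Lemma germ_res (U V : opens X) (Ux : U x) (Vx : V x) (h : V `<=` U) s :
  germ Vx (res h s) = germ Ux s.
Proof. exact: germ_of_res. Qed.

Lemma germ_surj (z : stalk) : exists (U : opens X) (Ux : U x) s, z = germ Ux s.
Proof. exact: germ_of_surj. Qed.

Lemma inv_atP (U : opens X) (Ux : U x) (s : sect X U) :
  inv_at s x <-> invertible (germ Ux s).
Proof.
split=> [[V [h [Vx iV]]]|[z]].
  by rewrite -(germ_res Ux Vx h); exact: invertible_morph.
have [V [Vx [t ->]]] := germ_surj z.
have l : meet U V `<=` U := @meetl _ _ _.
have r : meet U V `<=` V := @meetr _ _ _.
have UVx : meet U V x by [].
rewrite -(germ_res Ux UVx l) -(germ_res Vx UVx r) -rmorphM -(rmorph1 (germ UVx)).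
move=> /germP [W [h [h' [Wx e]]]].
exists W, (subset_trans h l); split=> //; exists (res h (res r t)).
by rewrite -(res_comp l h) -rmorphM e rmorph1.
Qed.
End Stalk.
Arguments stalk : clear implicits.
Arguments germ {X x U} Ux.

(** * Sections and their germs *)

Section RingedSpace.
Variable X : ringed_space.
Implicit Types U V W : opens X.

Lemma germ_ext U (s t : sect X U) :
  (forall x (Ux : U x), germ Ux s = germ Ux t) -> s = t.
Proof.
move=> st.
have H (x : {x | U x}) : same_germ (sval x) s t.
  by apply/(germP (svalP x) (svalP x)); exact: st.
pose C x := projT1 (cid (H x)).
have CP x : exists (h h' : C x `<=` U), C x (sval x) /\ res h s = res h' t.
  by rewrite /C; case: cid.
have hC x : C x `<=` U by have [] := CP x.
apply: (sect_separated (hC := hC)) => [x Ux|x].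
  by exists (exist _ x Ux); have [h [h' []]] := CP (exist _ x Ux).
by have [h [h' [_]]] := CP x; rewrite (res_irr h (hC x)) (res_irr h' (hC x)).
Qed.

Lemma inv_at_res U V (h : V `<=` U) (s : sect X U) x :
  V x -> inv_at (res h s) x <-> inv_at s x.
Proof.
by move=> Vx; rewrite (inv_atP Vx) (inv_atP (h x Vx)) (germ_res (h x Vx)).
Qed.

Lemma inv_atM U (s t : sect X U) x :
  U x -> inv_at (s * t) x <-> inv_at s x /\ inv_at t x.
Proof. by move=> Ux; rewrite !(inv_atP Ux) rmorphM; exact: invertibleM. Qed.

Lemma inv_atX U (s : sect X U) n x : U x -> inv_at s x -> inv_at (s ^+ n) x.
Proof. by move=> Ux; rewrite !(inv_atP Ux) rmorphXn; exact: invertibleX. Qed.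

Lemma inv_at1 U x : U x -> inv_at (1 : sect X U) x.
Proof. by move=> Ux; rewrite (inv_atP Ux) rmorph1; exact: invertible1. Qed.

(** Inverses are unique, hence local inverses glue. *)
Lemma invertible_pointwise U (s : sect X U) :
  (forall x, U x -> inv_at s x) -> invertible s.
Proof.
move=> inv_s.
have H (x : {x | U x}) : inv_at s (sval x) by exact/inv_s/svalP.
pose C x := projT1 (cid (H x)).
have CP x : exists h : C x `<=` U, C x (sval x) /\ invertible (res h s).
  by rewrite /C; case: cid.
have hC x : C x `<=` U by have [] := CP x.
have inv_res x : invertible (res (hC x) s).
  by have [h [_]] := CP x; rewrite (res_irr h (hC x)).
pose t x := projT1 (cid (inv_res x)).
have tP x : res (hC x) s * t x = 1 by rewrite /t; case: cid.
have cov x : U x -> exists i, C i x.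
  by move=> Ux; exists (exist _ x Ux); have [h []] := CP (exist _ x Ux).
have [|u uP] := sect_glue hC cov (s := t).
  move=> i j W hi hj; have hW := subset_trans hi (hC i).
  have e k (hk : W `<=` C k) : res hk (t k) * res hW s = 1.
    by rewrite -(res_comp (hC k) hk) -rmorphM mulrC tP rmorph1.
  apply: (@invertible_inj _ (res hW s)); last by rewrite !e.
  by exists (res hi (t i)); rewrite mulrC e.
exists u; apply: (sect_separated (hC := hC) cov) => i.
by rewrite rmorphM uP tP rmorph1.
Qed.

Lemma invertible_basic U (s : sect X U) :
  invertible (res (@basic_open_sub X U s) s).
Proof. by apply: invertible_pointwise => x sx; apply/inv_at_res. Qed.

Lemma sect_empty U (s t : sect X U) : (forall x, ~ U x) -> s = t.
Proof. by move=> U0; apply: germ_ext => x Ux; case: (U0 x Ux). Qed.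
End RingedSpace.

(** * Rings of fractions *)

Definition rmorphism_of (A B : comPzRingType) (f : A -> B)
    (fB : zmod_morphism f) (fM : monoid_morphism f) : {rmorphism A -> B} :=
  HB.pack f (GRing.isZmodMorphism.Build A B f fB)
    (GRing.isMonoidMorphism.Build A B f fM).

(** When every element of [L] is a fraction of elements of [lam A], a map on
[A] that inverts what [lam] inverts extends to [L]: the value at [z] is the
common value of the quotients [psi c / psi b] with [z = lam c / lam b]. *)
Section Fractions.
Variables (A L S : comPzRingType) (lam : {rmorphism A -> L}).
Hypothesis frac : forall z, exists b c,
  invertible (lam b) /\ z * lam b = lam c.

Lemma frac_morph_uniq (s s' : {rmorphism L -> S}) :
  (forall a, s (lam a) = s' (lam a)) -> s =1 s'.
Proof.
move=> ss' z; have [b [c [ib zb]]] := frac z.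
have /invertible_inj : invertible (s (lam b)) by exact: invertible_morph.
by apply; rewrite -rmorphM zb ss' ss' -rmorphM zb.
Qed.

Variable psi : {rmorphism A -> S}.
Hypothesis ker : forall c, lam c = 0 -> exists b, invertible (lam b) /\ b * c = 0.
Hypothesis inv : forall b, invertible (lam b) -> invertible (psi b).

Let quo z w := forall b c, invertible (lam b) -> z * lam b = lam c ->
  w * psi b = psi c.

Let quo_ex z : exists w, quo z w.
Proof.
have [b0 [c0 [ib0 zb0]]] := frac z; have [d b0d] := inv ib0.
exists (psi c0 * d) => b c ib zb; apply: (invertible_inj (inv ib0)).
have /ker [a [ia]] : lam (c * b0 - c0 * b) = 0.
  by rewrite rmorphB !rmorphM -zb -zb0 mulrAC subrr.
move/(congr1 psi); rewrite rmorphM rmorphB !rmorphM rmorph0 mulrC => e.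
have : psi c * psi b0 - psi c0 * psi b = 0.
  by apply: (invertible_inj (inv ia)); rewrite e mul0r.
move/subr0_eq ->; rewrite -!mulrA; congr (_ * _).
by rewrite mulrCA (mulrC d) b0d mulr1.
Qed.

Lemma frac_morph : exists s : {rmorphism L -> S}, forall a, s (lam a) = psi a.
Proof.
pose s z := projT1 (cid (quo_ex z)).
have sP z : quo z (s z) by rewrite /s; case: cid.
have s_eq z w b c : invertible (lam b) -> z * lam b = lam c ->
    w * psi b = psi c -> s z = w.
  by move=> ib zb wb; apply: (invertible_inj (inv ib)); rewrite wb; exact: sP.
have sa a : s (lam a) = psi a.
  apply: (@s_eq _ _ 1 a); rewrite ?rmorph1 ?mulr1 //; exact: invertible1.
have sB : zmod_morphism s.
  move=> z z'; have [b [c [ib zb]]] := frac z; have [b' [c' [ib' zb']]] := frac z'.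
  apply: (@s_eq _ _ (b * b') (c * b' - c' * b)).
  - by rewrite rmorphM; apply/invertibleM.
  - rewrite rmorphM rmorphB !rmorphM -zb -zb' mulrBl mulrA; congr (_ - _).
    by rewrite (mulrC (lam b)) mulrA.
  - rewrite rmorphM rmorphB !rmorphM -(sP _ _ _ ib zb) -(sP _ _ _ ib' zb').
    by rewrite mulrBl mulrA; congr (_ - _); rewrite (mulrC (psi b)) mulrA.
have sM : monoid_morphism s.
  split=> [|z z']; first by rewrite -(rmorph1 lam) sa rmorph1.
  have [b [c [ib zb]]] := frac z; have [b' [c' [ib' zb']]] := frac z'.
  apply: (@s_eq _ _ (b * b') (c * c')).
  - by rewrite rmorphM; apply/invertibleM.
  - by rewrite !rmorphM -zb -zb' mulrACA.
  - by rewrite !rmorphM -(sP _ _ _ ib zb) -(sP _ _ _ ib' zb') mulrACA.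
by exists (rmorphism_of sB sM).
Qed.
End Fractions.

(** * Points and stalks of spectra *)

(** That the ideal is closed under sums and does not contain 1 is the locality
of the stalk at [x]. *)
Lemma prime_of_point (T : lrspace) (W : opens T) (B : comPzRingType)
    (psi : {rmorphism B -> sect T W}) x :
  W x -> prime_ideal [set b | ~ inv_at (psi b) x].
Proof.
move=> Wx; have [l0 lD] := @stalk_local T x W Wx; split=> /=.
- by rewrite rmorph0.
- by move=> a b na nb; rewrite rmorphD => /lD [].
- by move=> a b nb; rewrite rmorphM => /(inv_atM _ _ Wx) [].
- by apply; rewrite rmorph1; exact: inv_at1.
- move=> a b; rewrite rmorphM (inv_atM _ _ Wx) => nab.
  by apply: contrapT => /not_orP [/contrapT ia /contrapT ib]; exact: nab.
Qed.

Section Spec.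
Variables (X : lrspace) (U : opens X) (A : comPzRingType).
Variables (phi : {rmorphism A -> sect X U}) (hphi : is_Spec phi).

Lemma Spec_point (p : set A) : prime_ideal p ->
  exists x, U x /\ forall a, p a <-> ~ inv_at (phi a) x.
Proof.
by case: hphi => + _ _ => /[apply] -[x [[Ux ->] _]]; exists x.
Qed.

Lemma Spec_point_inj x y : U x -> U y ->
  (forall a, inv_at (phi a) x <-> inv_at (phi a) y) -> x = y.
Proof.
move=> Ux Uy xy; case: hphi => + _ _.
move=> /(_ _ (prime_of_point phi Ux)) [z [_ zu]].
rewrite -(zu x) // -(zu y) //; split=> //.
by apply/seteqP; split=> a /=; rewrite xy.
Qed.

(** The open set [V] need not be contained in [U]. *)
Lemma Spec_base (V : opens X) x : U x -> V x ->
  exists a, [/\ inv_at (phi a) x, basic_open (phi a) `<=` V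
    & basic_open (phi a) `<=` U].
Proof.
move=> Ux Vx; case: hphi => _ + _.
move=> /(_ (meet U V) x (@meetl _ _ _) (conj Ux Vx)) [a [ax aUV]].
by exists a; split=> // y /aUV [].
Qed.

Lemma Spec_frac a (s : sect X (basic_open (phi a))) : exists n c,
  s * res (@basic_open_sub _ _ _) (phi a) ^+ n = res (@basic_open_sub _ _ _) (phi c).
Proof. by case: hphi => _ _ /(_ a) [_ + _] => /(_ s). Qed.

Lemma Spec_ker a c : res (@basic_open_sub X U (phi a)) (phi c) = 0 ->
  exists n, a ^+ n * c = 0.
Proof. by case: hphi => _ _ /(_ a) [_ _]; exact. Qed.

(** This lemma and the next one say that the stalk at [x] is the localization
of [A] at the prime of [x]. *)
Lemma stalk_frac x (Ux : U x) (z : stalk X x) : exists b c,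
  invertible (germ Ux (phi b)) /\ z * germ Ux (phi b) = germ Ux (phi c).
Proof.
have [V [Vx [s ->]]] := germ_surj z.
have [a [ax aV aU]] := Spec_base Ux Vx.
have [n [c e]] := Spec_frac (res aV s).
exists (a ^+ n), c; split.
  by rewrite !rmorphXn; apply/invertibleX/inv_atP.
have Dx : basic_open (phi a) x := ax.
rewrite -(germ_res Vx Dx aV) -2!(germ_res Ux Dx (@basic_open_sub _ _ _)).
by rewrite -rmorphM !rmorphXn e.
Qed.

Lemma stalk_ker x (Ux : U x) c : germ Ux (phi c) = 0 -> exists b,
  invertible (germ Ux (phi b)) /\ b * c = 0.
Proof.
rewrite -[0](rmorph0 (germ Ux)) => /germP [V [h [h' [Vx e]]]].
have [a [ax aV aU]] := Spec_base Ux Vx.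
have [|n ac] := @Spec_ker a c.
  by rewrite -(res_comp h aV) e !rmorph0.
by exists (a ^+ n); split=> //; rewrite !rmorphXn; apply/invertibleX/inv_atP.
Qed.
End Spec.

(** * Morphisms from maps on stalks *)

(** The gluing axiom freed from the compatibility condition: sections with
prescribed germs agree on overlaps, because their germs do. *)
Lemma glue_germs (X : ringed_space) (U : opens X)
    (g : forall x, U x -> stalk X x) :
  (forall x, U x -> exists (W : opens X) (h : W `<=` U) (t : sect X W),
    W x /\ forall y (Wy : W y), germ Wy t = g y (h y Wy)) ->
  exists t : sect X U, forall x (Ux : U x), germ Ux t = g x Ux.
Proof.
move=> loc.
have H (x : {x | U x}) := loc _ (svalP x).
pose C x := projT1 (cid (H x)).
have CP x : exists (h : C x `<=` U) (t : sect X (C x)),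
  C x (sval x) /\ forall y (Cy : C x y), germ Cy t = g y (h y Cy).
  by rewrite /C; case: cid.
have hC x : C x `<=` U by have [] := CP x.
have tex x : exists t : sect X (C x),
    forall y (Cy : C x y), germ Cy t = g y (hC x y Cy).
  have [h [t [_ tg]]] := CP x; exists t => y Cy.
  by rewrite tg (Prop_irrelevance (h y Cy) (hC x y Cy)).
pose t x := projT1 (cid (tex x)).
have tP x y (Cy : C x y) : germ Cy (t x) = g y (hC x y Cy).
  by rewrite /t; case: cid => u /= ->.
have cov x : U x -> exists i, C i x.
  by move=> Ux; exists (exist _ x Ux); have [h [u []]] := CP (exist _ x Ux).
have [|u uP] := sect_glue hC cov (s := t).
  move=> i j W hi hj; apply: germ_ext => y Wy.
  rewrite (germ_res (hi y Wy)) (germ_res (hj y Wy)) !tP.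
  by rewrite (Prop_irrelevance (hC i y _) (hC j y (hj y Wy))).
exists u => x Ux; have [i Cx] := cov x Ux.
by rewrite -(germ_res Ux Cx (hC i)) uP tP (Prop_irrelevance Ux (hC i x Cx)).
Qed.

Section StalkMor.
Variables (T Y : lrspace) (f : T -> Y) (fc : continuous f).
Variable sigma : forall x, {rmorphism stalk Y (f x) -> stalk T x}.
Hypothesis sigma_local : forall x z, invertible (sigma x z) -> invertible z.
Hypothesis sigma_sect : forall (V : opens Y) (s : sect Y V) x, V (f x) ->
  exists (W : opens T) (h : W `<=` preim fc V) (t : sect T W),
    W x /\ forall y (Wy : W y), germ Wy t = sigma y (germ (h y Wy : V (f y)) s).

Let co_ex (V : opens Y) (s : sect Y V) : exists t : sect T (preim fc V),
  forall x (Wx : preim fc V x), germ Wx t = sigma x (germ (Wx : V (f x)) s).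
Proof.
apply: (@glue_germs T (preim fc V) (fun x Wx => sigma x (germ (Wx : V (f x)) s))).
by move=> x; exact: sigma_sect.
Qed.

Let co (V : opens Y) (s : sect Y V) : sect T (preim fc V) :=
  projT1 (cid (co_ex s)).

Let coP (V : opens Y) (s : sect Y V) x (Wx : preim fc V x) :
  germ Wx (co s) = sigma x (germ (Wx : V (f x)) s).
Proof. by rewrite /co; case: cid. Qed.

Let co_zmod V : zmod_morphism (@co V).
Proof. by move=> s t; apply: germ_ext => x Wx; rewrite rmorphB !coP !rmorphB. Qed.
Let co_monoid V : monoid_morphism (@co V).
Proof.
split=> [|s t]; apply: germ_ext => x Wx.
  by rewrite coP !rmorph1.
by rewrite rmorphM !coP !rmorphM.
Qed.

Let com V := rmorphism_of (@co_zmod V) (@co_monoid V).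

Let com_res (V W : opens Y) (h : W `<=` V) (h' : preim fc W `<=` preim fc V) s :
  com W (res h s) = res h' (com V s).
Proof.
apply: germ_ext => x Wx; rewrite (germ_res (h' x Wx)) !coP.
by rewrite (germ_res (h' x Wx : V (f x))).
Qed.

Let com_local (V : opens Y) (s : sect Y V) x :
  V (f x) -> inv_at (com V s) x -> inv_at s (f x).
Proof.
move=> Vx; rewrite (inv_atP (Vx : preim fc V x)) coP => /sigma_local ?.
exact/(inv_atP Vx).
Qed.

Definition stalk_mor : mor T Y := Mor com_res com_local.

Lemma germ_stalk_mor (V : opens Y) (s : sect Y V) x (Wx : preim fc V x) :
  germ Wx (comor stalk_mor V s) = sigma x (germ (Wx : V (f x)) s).
Proof. exact: coP. Qed.
End StalkMor.

(** * Comparison of morphisms on charts *)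

Section Pull.
Variables (T Y : lrspace) (f : mor T Y).

Lemma pull_irr (V : opens Y) (W : opens T) (h h' : W `<=` pre f V) s :
  pull h s = pull h' s.
Proof. by rewrite (Prop_irrelevance h h'). Qed.

Lemma pull_id (V : opens Y) (h : pre f V `<=` pre f V) s :
  pull h s = comor f V s.
Proof. exact: res_id. Qed.

Lemma pull_res (V V' : opens Y) (W W' : opens T) (h : W `<=` pre f V)
    (h' : W' `<=` pre f V') (k : V' `<=` V) (l : W' `<=` W) s :
  pull h' (res k s) = res l (pull h s).
Proof.
have k' : pre f V' `<=` pre f V by move=> x; exact: k.
rewrite /pull /= (comor_res k k').
by rewrite (res_comp _ _ (subset_trans h' k')) (res_comp _ _ (subset_trans h' k')).
Qed.

Lemma inv_at_pull (V : opens Y) (W : opens T) (h : W `<=` pre f V) s x :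
  W x -> inv_at (pull h s) x <-> inv_at s (f x).
Proof.
move=> Wx; rewrite /pull /= inv_at_res //; split=> [|[V' [k [Vx iV]]]].
  by apply: comor_local; exact: h.
exists (pre f V'), (fun y => k (f y)); split=> //.
by rewrite -(comor_res k); exact: invertible_morph.
Qed.
End Pull.

Lemma pull_comp (T Y Z : lrspace) (g : mor Y Z) (f : mor T Y) (V : opens Z)
    (W : opens Y) (O : opens T) (h : O `<=` pre (comp_mor g f) V)
    (k : W `<=` pre g V) (l : O `<=` pre f W) s :
  pull h s = pull l (pull k s).
Proof.
have k' : pre f W `<=` pre f (pre g V) by move=> x; exact: k.
rewrite /pull /= (comor_res _ k').
by rewrite (res_comp _ _ (subset_trans l k')) (res_comp _ _ (subset_trans l k')).
Qed.

(** A point of [Spec A] is determined by its prime, and near it every section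
is a fraction of elements of [A]; so a morphism into [Spec A] is determined by
its effect on [A]. *)
Lemma mor_eq_local (T Y : lrspace) (f g : mor T Y) :
  (forall x : T, exists (U : opens Y) (A : comPzRingType)
      (phi : {rmorphism A -> sect Y U}) (W : opens T)
      (hf : W `<=` pre f U) (hg : W `<=` pre g U),
    [/\ W x, is_Spec phi & forall a, pull hf (phi a) = pull hg (phi a)]) ->
  mor_eq f g.
Proof.
move=> loc; have fg : f =1 g.
  move=> x; have [U [A [phi [W [hf [hg [Wx hphi e]]]]]]] := loc x.
  apply: (Spec_point_inj hphi (hf x Wx) (hg x Wx)) => a.
  by rewrite -(inv_at_pull hf _ Wx) -(inv_at_pull hg _ Wx) e.
split=> // V O hf hg s; apply: germ_ext => x Ox.
have [U [A [phi [W [kf [kg [Wx hphi e]]]]]]] := loc x.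
have [a [ax aV aU]] := Spec_base hphi (kf x Wx) (hf x Ox : V (f x)).
have [n [c sc]] := Spec_frac hphi (res aV s).
pose D := basic_open (phi a).
pose O' := meet O (meet W (pre f D)).
have lO : O' `<=` O by move=> y [].
have lW : O' `<=` W by move=> y [_ []].
have O'x : O' x by [].
have lf : O' `<=` pre f D by move=> y [_ []].
have lg : O' `<=` pre g D by move=> y [_ [_]]; rewrite /pre /preim /= fg.
rewrite -(germ_res Ox O'x lO) -[RHS](germ_res Ox O'x lO).
rewrite -(pull_res hf lf aV) -(pull_res hg lg aV); congr (germ _ _).
have pa : pull lf (res aU (phi a)) = pull lg (res aU (phi a)).
  by rewrite (pull_res kf _ _ lW) (pull_res kg _ _ lW) e.
have pc : pull lf (res aU (phi c)) = pull lg (res aU (phi c)).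
  by rewrite (pull_res kf _ _ lW) (pull_res kg _ _ lW) e.
apply: (@invertible_inj _ (pull lf (res aU (phi a) ^+ n))).
  apply: invertible_morph; apply: invertibleX.
  by rewrite (res_irr aU (@basic_open_sub _ _ _)); exact: invertible_basic.
have pan : pull lf (res aU (phi a) ^+ n) = pull lg (res aU (phi a) ^+ n).
  by rewrite !rmorphXn pa.
rewrite [in RHS]pan -!rmorphM.
by rewrite (res_irr aU (@basic_open_sub _ _ _)) sc -(res_irr aU) pc.
Qed.

(** * Gluing morphisms given on charts *)
Section GlueCharts.
Variables (T Y : lrspace) (I : Type).
Variables (U : I -> opens Y) (W : I -> opens T) (B : I -> comPzRingType).
Variables (phi : forall i, {rmorphism B i -> sect Y (U i)})
          (psi : forall i, {rmorphism B i -> sect T (W i)}).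
Hypothesis hphi : forall i, is_Spec (phi i).
Hypothesis cover : forall x, exists i, W i x.

(** The restriction maps [B i -> B k] need not be given: it is enough that each
[b] has some restriction [b'] that serves both [phi] and [psi]. *)
Definition refines k i := exists (hU : U k `<=` U i) (hW : W k `<=` W i),
  forall b, exists b', res hU (phi i b) = phi k b' /\ res hW (psi i b) = psi k b'.

Hypothesis directed : forall i j x, W i x -> W j x ->
  exists k, [/\ W k x, refines k i & refines k j].

(* Whether [y] is the image of [x] is asked of all charts at once, so that the
   map on points involves no choice of a chart. *)
Let image x y := forall i, W i x ->
  U i y /\ forall b, inv_at (phi i b) y <-> inv_at (psi i b) x.

Let image_ex x : exists y, image x y.
Proof.
have [i Wi] := cover x.
have [y [Uy yP]] := Spec_point (hphi i) (prime_of_point (psi i) Wi).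
have {}yP b : inv_at (phi i b) y <-> inv_at (psi i b) x.
  by split=> h; apply: contrapT => n; [apply: (yP b).1 h|apply: (yP b).2 h].
exists y => j Wj; have [k [Wk [hUi [hWi ri]] [hUj [hWj rj]]]] := directed Wi Wj.
have [z [Uz zP]] := Spec_point (hphi k) (prime_of_point (psi k) Wk).
have {}zP b : inv_at (phi k b) z <-> inv_at (psi k b) x.
  by split=> h; apply: contrapT => n; [apply: (zP b).1 h|apply: (zP b).2 h].
have yz : y = z.
  apply: (Spec_point_inj (hphi i) Uy (hUi z Uz)) => b; have [b' [e e']] := ri b.
  by rewrite yP -(inv_at_res hWi _ Wk) e' -zP -e inv_at_res.
rewrite yz; split=> [|b]; first by move: (hUj z Uz).
by have [b' [e e']] := rj b; rewrite -(inv_at_res hUj _ Uz) e zP -e' inv_at_res.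
Qed.

Let f x := projT1 (cid (image_ex x)).
Let fP x : image x (f x). Proof. by rewrite /f; case: cid. Qed.
Let fU i x : W i x -> U i (f x). Proof. by case/fP. Qed.
Let f_inv i x (b : B i) : W i x -> inv_at (phi i b) (f x) <-> inv_at (psi i b) x.
Proof. by case/fP. Qed.

Let f_cont : continuous f.
Proof.
apply/continuousP => V Vo; rewrite openE => x /= Vx.
have [i Wx] := cover x.
have [a [ax aV aU]] := Spec_base (hphi i) (fU Wx) (Vx : Opens Vo (f x)).
rewrite /interior nbhsE; exists (basic_open (psi i a)).
  by split; [exact: oset_open|exact/f_inv].
move=> y ay; apply: aV; apply/f_inv => //; exact: basic_open_sub ay.
Qed.

(* The map on stalks extends the given map on one chart; on any other chart it
   is the given one too, since both restrict to a common refinement, where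
   extensions are unique. *)
Let sigma_ex x : exists s : {rmorphism stalk Y (f x) -> stalk T x},
  forall i (Wx : W i x) b, s (germ (fU Wx) (phi i b)) = germ Wx (psi i b).
Proof.
have ex i (Wx : W i x) : exists s : {rmorphism stalk Y (f x) -> stalk T x},
    forall b, s (germ (fU Wx) (phi i b)) = germ Wx (psi i b).
  apply: (@frac_morph _ _ _ (germ (fU Wx) \o phi i) _ (germ Wx \o psi i)).
  - exact: (stalk_frac (hphi i)).
  - exact: (stalk_ker (hphi i)).
  - by move=> b /=; rewrite -!inv_atP f_inv.
have [i Wi] := cover x; have [s sP] := ex i Wi.
exists s => j Wj b; have [k [Wk [hUi [hWi ri]] [hUj [hWj rj]]]] := directed Wi Wj.
have [s' s'P] := ex k Wk.
have -> : s (germ (fU Wj) (phi j b)) = s' (germ (fU Wj) (phi j b)).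
  apply: (@frac_morph_uniq _ _ _ (germ (fU Wi) \o phi i)).
    exact: (stalk_frac (hphi i)).
  move=> c /=; have [c' [e e']] := ri c.
  rewrite sP -(germ_res Wi Wk hWi) e' -s'P -e; congr (s' _).
  exact: germ_res.
have [b' [e e']] := rj b.
rewrite -(germ_res Wj Wk hWj) e' -s'P -e; congr (s' _).
by rewrite (germ_res (fU Wj)).
Qed.

Let sigma x := projT1 (cid (sigma_ex x)).
Let sigmaP x i (Wx : W i x) b :
  sigma x (germ (fU Wx) (phi i b)) = germ Wx (psi i b).
Proof. by rewrite /sigma; case: cid. Qed.

Let sigma_local x z : invertible (sigma x z) -> invertible z.
Proof.
have [i Wx] := cover x.
have [b [c [ib zb]]] := stalk_frac (hphi i) (fU Wx) z.
move=> iz; have : invertible (sigma x (z * germ (fU Wx) (phi i b))).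
  by rewrite rmorphM; apply/invertibleM; split=> //; exact: invertible_morph.
rewrite zb sigmaP -inv_atP -f_inv // (inv_atP (fU Wx)) -zb.
by move/invertibleM => [].
Qed.

Let sigma_sect (V : opens Y) (s : sect Y V) x : V (f x) ->
  exists (O : opens T) (h : O `<=` preim f_cont V) (t : sect T O),
    O x /\ forall y (Oy : O y),
      germ Oy t = sigma y (germ (h y Oy : V (f y)) s).
Proof.
move=> Vx; have [i Wx] := cover x.
have [a [ax aV aU]] := Spec_base (hphi i) (fU Wx) Vx.
have [n [c sc]] := Spec_frac (hphi i) (res aV s).
(* Near [f x] the section [s] is [phi c / (phi a)^n], so near [x] its pullback
   is [psi c / (psi a)^n]. *)
pose O := basic_open (psi i a).
have OW : O `<=` W i := @basic_open_sub _ _ _.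
have OD y : O y -> basic_open (phi i a) (f y).
  by move=> Oy; apply/f_inv => //; exact: OW.
have OV : O `<=` preim f_cont V by move=> y /OD /aV.
have [d ad] : invertible (res OW (psi i a) ^+ n).
  apply: invertibleX; rewrite (res_irr OW (@basic_open_sub _ _ _)).
  exact: invertible_basic.
exists O, OV, (res OW (psi i c) * d); split; first exact/f_inv.
move=> y Oy; have Wy := OW y Oy.
have ia : invertible (germ Oy (res OW (psi i a) ^+ n)).
  by apply: invertible_morph; exists d.
apply: (invertible_inj ia); rewrite -rmorphM -mulrA [d * _]mulrC ad mulr1.
rewrite (germ_res Wy) rmorphXn (germ_res Wy) -!sigmaP -rmorphXn -rmorphM.
have Dy : basic_open (phi i a) (f y) := OD y Oy.
congr (sigma y _); rewrite -(germ_res (OV y Oy : V (f y)) Dy aV).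
by rewrite -2!(germ_res (fU Wy) Dy (@basic_open_sub _ _ _)) -rmorphXn -rmorphM sc.
Qed.

Lemma glue_charts : exists g : mor T Y, forall i,
  exists h : W i `<=` pre g (U i), forall b, pull h (phi i b) = psi i b.
Proof.
exists (stalk_mor sigma_local sigma_sect) => i.
have h : W i `<=` pre (stalk_mor sigma_local sigma_sect) (U i).
  by move=> x; exact: fU.
exists h => b; apply: germ_ext => x Wx.
rewrite /pull /= (germ_res (h x Wx)) (germ_stalk_mor sigma_local sigma_sect).
by rewrite -sigmaP; congr (sigma x (germ _ _)); exact: Prop_irrelevance.
Qed.
End GlueCharts.

(** * Closed immersions *)

Section ClosedImmersion.
Variables (T Y : lrspace) (f : mor T Y).

(** The restriction of [f] over [U] is the map of spectra given by a
surjection of rings. *)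
Definition closed_chart (U : opens Y) := exists (W : opens T)
    (h : W `<=` pre f U) (A B : comPzRingType) (chi : {rmorphism A -> sect T W})
    (phi : {rmorphism B -> sect Y U}) (q : {rmorphism B -> A}),
  [/\ pre f U `<=` W, is_Spec chi, is_Spec phi, forall a, exists b, q b = a
    & forall b, pull h (phi b) = chi (q b)].

Hypothesis charts : forall y, exists U : opens Y, U y /\ closed_chart U.

Lemma closed_chart_inj : injective f.
Proof.
move=> x y fxy.
have [U [Ux [W [h [A [B [chi [phi [q [h' hchi hphi qs e]]]]]]]]]] := charts (f x).
have Wx : W x by exact: h'.
have Wy : W y by apply: h'; rewrite /pre /preim /= -fxy.
apply: (Spec_point_inj hchi Wx Wy) => a; have [b <-] := qs a.
by rewrite -e !inv_at_pull // fxy.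
Qed.

(** A point over which the kernel of the surjection vanishes is a prime of
the quotient ring; elsewhere an element of the kernel is invertible. *)
Lemma closed_chart_closed : closed (range f).
Proof.
rewrite -openC openE => y /= nfy.
have [U [Uy [W [h [A [B [chi [phi [q [h' hchi hphi qs e]]]]]]]]]] := charts y.
have [b [qb iby]] : exists b, q b = 0 /\ inv_at (phi b) y.
  apply: contrapT => nb; apply: nfy.
  (* If no such [b] exists, then the prime of [y] contains the kernel of [q],
     and its image [p] is a prime whose point is mapped to [y]. *)
  have ker b : q b = 0 -> ~ inv_at (phi b) y by move=> qb ib; apply: nb; exists b.
  have [p0 pD pM p1 pP] := prime_of_point phi Uy.
  pose p := [set a | exists b, q b = a /\ ~ inv_at (phi b) y].
  have pq b : p (q b) -> ~ inv_at (phi b) y.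
    move=> [b' [qb' nb']]; rewrite -(subrK b' b); apply: pD => //=.
    by apply: ker; rewrite rmorphB qb' subrr.
  have pp : prime_ideal p.
    split.
    - by exists 0; rewrite rmorph0.
    - move=> _ _ [b [<- nib]] [c [<- nic]]; exists (b + c).
      by rewrite rmorphD; split=> //; exact: pD.
    - move=> a _ [c [<- nic]]; have [b <-] := qs a; exists (b * c).
      by rewrite rmorphM; split=> //; exact: pM.
    - by rewrite -(rmorph1 q) => /pq.
    - move=> a c; have [a' <-] := qs a; have [c' <-] := qs c.
      by rewrite -rmorphM => /pq /pP [n|n]; [left; exists a'|right; exists c'].
  have [x [Wx xP]] := Spec_point hchi pp.
  exists x => //; apply: (Spec_point_inj hphi (h x Wx) Uy) => b.
  rewrite -(inv_at_pull h _ Wx) e; split=> i; apply: contrapT => n.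
    by apply: (xP (q b)).1 i; exists b.
  by apply: pq i; exact/xP.
rewrite /interior nbhsE; exists (basic_open (phi b)).
  by split; [exact: oset_open|].
move=> z bz [x _ fxz]; have Uz : U (f x) by rewrite fxz; exact: basic_open_sub bz.
have Wx := h' x Uz; have [l0 _] := @stalk_local T x W Wx; apply: l0.
by rewrite -(rmorph0 chi) -qb -e inv_at_pull // fxz.
Qed.

(** Every basic open set of the source is cut out by one of the target,
because the ring map is surjective. *)
Lemma closed_chart_embedding (O : opens T) :
  exists V : opens Y, forall x, O x <-> V (f x).
Proof.
(* The largest candidate: the union of all [V] with preimage inside [O]. *)
pose D := [set V : opens Y | forall x, V (f x) -> O x].
have oV : open (\bigcup_(V in D) V) by apply: bigcup_open => V _; exact: oset_open.
exists (Opens oV) => x; split=> [Ox|[V DV Vx]]; last exact: DV.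
have [U [Ux [W [h [A [B [chi [phi [q [h' hchi hphi qs e]]]]]]]]]] := charts (f x).
have Wx := h' x Ux.
have [a [ax aO aW]] := Spec_base hchi Wx Ox; have [b qb] := qs a.
exists (basic_open (phi b)); last first.
  by rewrite /basic_open /= -(inv_at_pull h _ Wx) e qb.
move=> z bz; have Wz := h' z (basic_open_sub bz : U (f z)).
by apply: aO; rewrite -qb -e; apply/inv_at_pull.
Qed.

(** Off the range there is nothing to lift, since the range is closed.  At a
point of the range, [t] is a fraction [chi a' / (chi a)^n] near it, and
[a] and [a'] lift along the surjection [q]. *)
Lemma closed_chart_surj (V : opens Y) (t : sect T (pre f V)) y : V y ->
  exists (W : opens Y) (h : W `<=` V) (h' : pre f W `<=` pre f V)
         (s : sect Y W), W y /\ comor f W s = res h' t.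
Proof.
move=> Vy; have [[x _ fx]|nfy] := pselect (range f y); last first.
  have oC : open (~` range f) by rewrite openC; exact: closed_chart_closed.
  pose W := meet V (Opens oC); exists W, (@meetl _ _ _).
  have h' : pre f W `<=` pre f V by move=> z [].
  exists h', 0; split=> //; apply: sect_empty => z [_]; apply; by exists z.
have [U [Ux [W [h [A [B [chi [phi [q [h' hchi hphi qs e]]]]]]]]]] := charts (f x).
have Wx := h' x Ux; have Vx : pre f V x by rewrite /pre /preim /= fx.
have [a [ax aV aW]] := Spec_base hchi Wx Vx.
have [n [a' ta]] := Spec_frac hchi (res aV t).
have [b qb] := qs a; have [b' qb'] := qs a'.
pose D := basic_open (phi b); pose E := basic_open (chi a).
have DU : D `<=` U := @basic_open_sub _ _ _.
have EW : E `<=` W := @basic_open_sub _ _ _.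
pose O := meet V D.
have OV : O `<=` V := @meetl _ _ _.
have OD : O `<=` D := @meetr _ _ _.
have fOV : pre f O `<=` pre f V by move=> z; exact: OV.
have fOE : pre f O `<=` E.
  move=> z [_ Dz]; have Wz := h' z (DU _ Dz).
  by rewrite /E /basic_open /= -qb -e; apply/inv_at_pull.
have [d bd] : invertible (res DU (phi b) ^+ n).
  apply: invertibleX; rewrite (res_irr DU (@basic_open_sub _ _ _)).
  exact: invertible_basic.
have com c : comor f O (res OD (res DU (phi c))) = res fOE (res EW (chi (q c))).
  have hO : O `<=` U := subset_trans OD DU.
  have hO' : pre f O `<=` pre f U by move=> z; exact: hO.
  rewrite (res_comp _ _ hO) (comor_res hO hO') -e /pull /=.
  by rewrite !(res_comp _ _ (subset_trans fOE EW)) (res_comp _ _ hO').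
exists O, OV, fOV, (res OD (res DU (phi b') * d)); split.
  by split=> //; rewrite -fx /D /= -(inv_at_pull h _ Wx) e qb.
have ib : invertible (comor f O (res OD (res DU (phi b) ^+ n))).
  by do 2!apply: invertible_morph; exists d.
apply: (invertible_inj ib); rewrite -!rmorphM -mulrA [d * _]mulrC bd mulr1 com.
rewrite qb' [in RHS]rmorphXn [in RHS]rmorphXn com qb -(res_comp aV fOE).
by rewrite -rmorphXn -rmorphM !(res_irr EW (@basic_open_sub _ _ _)) ta.
Qed.

Lemma closed_immersion_charts : closed_immersion f.
Proof.
split; [exact: closed_chart_inj|exact: closed_chart_closed
       |exact: closed_chart_embedding|exact: closed_chart_surj].
Qed.
End ClosedImmersion.

(** * The affine open sets form a base *)

Lemma opens_eq (T : topologicalType) (U V : opens T) :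
  U `<=` V -> V `<=` U -> U = V.
Proof.
case: U V => [U oU] [V oV] /= UV VU; have E : U = V by exact/seteqP.
by subst V; rewrite (Prop_irrelevance oU oV).
Qed.

(** Over [D(s)] every section is a fraction [c / s^n], so that primes,
invertibility and localizations of the ring of sections over [D(s)] are read
off from those of the ring of sections over [U]. *)
Lemma affine_basic_open (X : lrspace) (U : opens X) (s : sect X U) :
  affine_open U -> affine_open (basic_open s).
Proof.
move=> hU; pose D := basic_open s.
pose DU : D `<=` U := @basic_open_sub _ _ _.
have iD : invertible (res DU s).
  exact: invertible_basic.
have fracD (t : sect X D) : exists n c, t * res DU s ^+ n = res DU c.
  exact: (Spec_frac hU t).
have inv_frac (t : sect X D) n c x : D x -> t * res DU s ^+ n = res DU c ->
    inv_at t x <-> inv_at c x.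
  move=> Dx e; rewrite -(inv_at_res DU c Dx) -e (inv_atM _ _ Dx).
  split=> [it|[]//]; split=> //; apply: inv_atX => //.
  exact/(inv_at_res DU s Dx).
split.
- move=> p [p0 pD pM p1 pP].
  have pq : prime_ideal [set c | p (res DU c)].
    split=> /= [|a b pa pb|a b pb| |a b]; rewrite ?rmorph0 ?rmorphD ?rmorphM ?rmorph1 //.
    + exact: pD.
    + exact: pM.
    + exact: pP.
  have ninv t : p t -> ~ invertible t.
    by move=> pt [t' tt']; apply: p1; rewrite -tt' mulrC; exact: pM.
  have [x [Ux /= xP]] := Spec_point hU pq.
  have Dx : D x.
    by apply: contrapT => ns; apply: (ninv _ _ iD); exact/xP.
  have pE : p = [set t | ~ inv_at t x].
    apply/seteqP; split=> t /=; have [n [c e]] := fracD t.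
      move=> pt; rewrite (inv_frac _ _ _ _ Dx e); apply/xP.
      by rewrite -e mulrC; exact: pM.
    rewrite (inv_frac _ _ _ _ Dx e) => /xP; rewrite -e => /pP [//|psn].
    by case: (ninv _ psn); exact: invertibleX.
  exists x; split=> // y [Dy pE'].
  apply: (Spec_point_inj hU Ux (DU y Dy)) => c /=.
  rewrite -(inv_at_res DU c Dx) -(inv_at_res DU c Dy).
  have : p (res DU c) <-> p (res DU c) by [].
  rewrite {1}pE pE' /= => E.
  by split=> i; apply: contrapT => n; [apply: E.2 i|apply: E.1 i].
- move=> V x VD Vx; have [a [ax aV aU]] := Spec_base hU (DU x (VD x Vx)) Vx.
  exists (res DU a); split; first by apply/inv_at_res => //; exact: VD.
  move=> y ay; apply: aV; have Dy := basic_open_sub ay.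
  exact: (inv_at_res DU a Dy).1 ay.
- move=> a; have [n [c e]] := fracD a.
  (* As [a = c / s^n], inverting [a] over [D(s)] is inverting [c * s] over [U]. *)
  have E : basic_open a = basic_open (c * s).
    apply: opens_eq => x ax.
      have Dx : D x := basic_open_sub ax.
      by apply/inv_atM; [exact: (DU _ Dx)|split=> //; exact: (inv_frac _ _ _ _ Dx e).1].
    have [ic Dx] := (inv_atM _ _ (basic_open_sub ax : U x)).1 ax.
    exact: (inv_frac _ _ _ _ Dx e).2.
  pose aD : basic_open a `<=` D := @basic_open_sub _ _ _.
  have cs : res DU (c * s) = a * res DU s ^+ n.+1.
    by rewrite rmorphM -e exprSr mulrA.
  have iX m : invertible (res DU s ^+ m) by exact: invertibleX.
  have csU : basic_open (c * s) `<=` U := @basic_open_sub _ _ _.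
  have aU : basic_open a `<=` U by rewrite E.
  have frac b : exists m d, b * res aU (c * s) ^+ m = res aU d.
    move: b aU {aD}; rewrite E => b aU; have [m [d ed]] := Spec_frac hU b.
    by exists m, d; rewrite (Prop_irrelevance aU (@basic_open_sub _ _ _)).
  have ker d : res aU d = 0 -> exists m, (c * s) ^+ m * d = 0.
    move: aU {aD frac}; rewrite E => aU ed; apply: (Spec_ker hU).
    by rewrite (res_irr _ aU).
  split=> [|b|t].
  + exact: invertible_basic.
  + have [m [d ed]] := frac b; have [u su] := iX (n.+1 * m)%N.
    exists m, (res DU d * u).
    rewrite -[LHS]/(b * res aD a ^+ m) -[RHS]/(res aD (res DU d * u)).
    have := ed; rewrite -!(res_comp DU aD) cs => {}ed.
    apply: (@invertible_inj _ (res aD (res DU s ^+ (n.+1 * m)))).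
      exact: invertible_morph.
    rewrite -[RHS]rmorphM -[d in RHS]mulr1 -mulrA [u * _]mulrC su !mulr1 -ed.
    by rewrite -mulrA; congr (_ * _); rewrite !rmorphXn rmorphM exprMn exprM rmorphXn.
  + rewrite -[LHS]/(res aD t) => t0; have [m [d ed]] := fracD t.
    have [|k kd] := ker d.
      by rewrite -(res_comp DU aD) -ed rmorphM t0 mul0r.
    exists k; move/(congr1 (res DU)): kd; rewrite rmorphM rmorphXn cs -ed rmorph0.
    rewrite exprMn -exprM mulrACA => kd.
    apply: (@invertible_inj _ (res DU s ^+ (n.+1 * k) * res DU s ^+ m)).
      exact/invertibleM.
    by rewrite kd mul0r.
Qed.

Lemma affine_base (X : scheme) (V : opens X) x : V x ->
  exists U : opens X, [/\ U x, U `<=` V & affine_open U].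
Proof.
move=> Vx; have [U [Ux hU]] := scheme_affine x.
have [s [sx sV _]] := Spec_base hU Ux Vx.
by exists (basic_open s); split=> //; exact: affine_basic_open.
Qed.

(** * Presented modules and symmetric algebras *)

(** A map on the symbols that respects the relations extends to the module.
The target is a ring over [R] rather than an [R]-module, since that is what
maps out of a symmetric algebra need. *)
Section ModuleMorphism.
Variables (R : comPzRingType) (G : Type) (Rel : mterm R G -> mterm R G -> Prop).
Variables (S : comPzRingType) (g : {rmorphism R -> S}) (u : G -> S).

Fixpoint meval (t : mterm R G) : S :=
  match t with
  | Mgen x => u x
  | Mzero => 0
  | Madd t1 t2 => meval t1 + meval t2
  | Mopp t1 => - meval t1
  | Mscale a t1 => g a * meval t1
  end.

Hypothesis u_rel : forall t t', Rel t t' -> meval t = meval t'.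

Lemma meval_cong t t' : mcong Rel t t' -> meval t = meval t'.
Proof.
elim=> //=.
- by move=> x y z _ -> _ ->.
- by move=> x x' y y' _ -> _ ->.
- by move=> x x' _ ->.
- by move=> a x x' _ ->.
- by move=> x y z; rewrite addrA.
- by move=> x y; rewrite addrC.
- by move=> x; rewrite add0r.
- by move=> x; rewrite addNr.
- by move=> a b x; rewrite rmorphM mulrA.
- by move=> x; rewrite rmorph1 mul1r.
- by move=> a x y; rewrite mulrDr.
- by move=> a b x; rewrite rmorphD mulrDl.
Qed.

Definition pm_eval (m : pmod Rel) : S := meval (repr m).

Lemma pm_evalE t : pm_eval (mpi Rel t) = meval t.
Proof. exact/meval_cong/mrepr. Qed.

Lemma pm_evalD m n : pm_eval (m + n) = pm_eval m + pm_eval n.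
Proof.
elim/mpiW: m => m; elim/mpiW: n => n.
by rewrite [_ + _]pm_addE !pm_evalE.
Qed.

Lemma pm_evalZ a m : pm_eval (a *: m) = g a * pm_eval m.
Proof. by elim/mpiW: m => m; rewrite [_ *: _]pm_scaleE !pm_evalE. Qed.
End ModuleMorphism.

Section SymMorphism.
Variables (R : comPzRingType) (M : lmodType R) (S : comPzRingType).
Variables (g : {rmorphism R -> S}) (u : M -> S).
Hypothesis uD : forall m n, u (m + n) = u m + u n.
Hypothesis uZ : forall a m, u (a *: m) = g a * u m.

Fixpoint seval (t : sterm M) : S :=
  match t with
  | Sconst a => g a
  | Sgen m => u m
  | Sadd t1 t2 => seval t1 + seval t2
  | Sopp t1 => - seval t1
  | Smul t1 t2 => seval t1 * seval t2
  end.

Lemma seval_cong t t' : scong t t' -> seval t = seval t'.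
Proof.
elim=> //=.
- by move=> a b; rewrite rmorphD.
- by move=> a b; rewrite rmorphM.
- by move=> x y z _ -> _ ->.
- by move=> x x' y y' _ -> _ ->.
- by move=> x x' _ ->.
- by move=> x x' y y' _ -> _ ->.
- by move=> x y z; rewrite addrA.
- by move=> x y; rewrite addrC.
- by move=> x; rewrite rmorph0 add0r.
- by move=> x; rewrite rmorph0 addNr.
- by move=> x y z; rewrite mulrA.
- by move=> x y; rewrite mulrC.
- by move=> x; rewrite rmorph1 mul1r.
- by move=> x y z; rewrite mulrDl.
Qed.

Definition sym_eval (x : Sym M) : S := seval (repr x).

Lemma sym_evalE t : sym_eval (spi t) = seval t.
Proof. exact/seval_cong/srepr. Qed.

Lemma sym_eval_zmod : zmod_morphism sym_eval.
Proof.
elim/spiW=> x; elim/spiW=> y.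
by rewrite -[spi x - spi y]/(sym_add _ (sym_opp _)) sym_oppE sym_addE !sym_evalE.
Qed.

Lemma sym_eval_monoid : monoid_morphism sym_eval.
Proof.
split; first by rewrite -[1]/(spi (Sconst M 1)) sym_evalE /= rmorph1.
elim/spiW=> x; elim/spiW=> y.
by rewrite -[spi x * spi y]/(sym_mul _ _) sym_mulE !sym_evalE.
Qed.

Definition sym_morph : {rmorphism Sym M -> S} :=
  rmorphism_of sym_eval_zmod sym_eval_monoid.

Lemma sym_morph_const a : sym_morph (sym_const M a) = g a.
Proof. exact: sym_evalE. Qed.

Lemma sym_morph_gen m : sym_morph (sym_gen m) = u m.
Proof. exact: sym_evalE. Qed.
End SymMorphism.

Section SymGen.
Variables (R : comPzRingType) (M : lmodType R).

Lemma sym_genD (m n : M) : sym_gen (m + n) = sym_gen m + sym_gen n.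
Proof. by rewrite [RHS]sym_addE; exact/spiP/scong_genD. Qed.

Lemma sym_genZ a (m : M) : sym_gen (a *: m) = sym_const M a * sym_gen m.
Proof. by rewrite [RHS]sym_mulE; exact/spiP/scong_genZ. Qed.
End SymGen.

(** The symmetric algebra of a presented module is generated, as a ring, by
the scalars and the symbols of the presentation. *)
Lemma sym_pmod_ind (R : comPzRingType) (G : Type)
    (Rel : mterm R G -> mterm R G -> Prop) (P : Sym (pmod Rel) -> Prop) :
  (forall a, P (sym_const _ a)) -> (forall x, P (sym_gen (pm_gen Rel x))) ->
  (forall x y, P x -> P y -> P (x + y)) ->
  (forall x y, P x -> P y -> P (x * y)) -> forall x, P x.
Proof.
move=> Pc Pg PD PM.
have PN x : P x -> P (- x).
  by move=> Px; rewrite -mulN1r -(rmorph1 (sym_const _)) -rmorphN; exact: PM (Pc _) Px.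
have Pm (m : pmod Rel) : P (sym_gen m).
  elim/mpiW: m; elim=> [x||x Px y Py|x Px|a x Px].
  - exact: Pg.
  - have -> : mpi Rel Mzero = 0 *: (0 : pmod Rel) by rewrite scale0r.
    by rewrite sym_genZ rmorph0 mul0r -(rmorph0 (sym_const _)); exact: Pc.
  - by rewrite -pm_addE sym_genD; exact: PD.
  - rewrite -pm_oppE -[pm_opp _]/(- mpi Rel x) -scaleN1r sym_genZ rmorphN rmorph1.
    by rewrite mulN1r; exact: PN.
  - by rewrite -pm_scaleE sym_genZ; exact: PM (Pc _) Px.
elim/spiW; elim=> [a|m|x Px y Py|x Px|x Px y Py].
- exact: Pc.
- exact: Pm.
- by rewrite -sym_addE; exact: PD.
- by rewrite -sym_oppE; exact: PN.
- by rewrite -sym_mulE; exact: PM.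
Qed.

(** * From tau-differentials to the prolongation *)

Section TauToD.
Variables (K : fieldType) (delta : K -> K).
Variables (R : comPzRingType) (k : {rmorphism K -> R}).

Let c := prolong_const delta k.
Let d := prolong_d delta k.

Lemma prolong_dD r s : d (r + s) = d r + d s.
Proof.
rewrite /d /prolong_d -rmorphD -sym_genD; congr (qpi _ (sym_gen _)).
by rewrite [RHS]pm_addE; exact/mpiP/mcong_rel/Kahler_add.
Qed.

Lemma prolong_dM r s : d (r * s) = c r * d s + c s * d r.
Proof.
rewrite /d /c /prolong_d /= -!rmorphM -!sym_genZ -rmorphD -sym_genD.
congr (qpi _ (sym_gen _)).
rewrite /Omega_d /pm_gen [_ *: mpi _ (Mgen _ s)]pm_scaleE.
rewrite [_ *: mpi _ (Mgen _ r)]pm_scaleE [RHS]pm_addE.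
exact/mpiP/mcong_rel/Kahler_mul.
Qed.

Lemma prolong_d_const a : d (k a) = c (k (delta a)).
Proof. by apply/qpiP/ideal_gen_in; exists a. Qed.

(** In the prolongation algebra [d a = delta a] for scalars [a], so
[delta a * d b] and [delta b * d a] both are [delta a * delta b]. *)
Lemma tau_rel_prolong t t' : tau_rel delta k t t' -> meval c d t = meval c d t'.
Proof.
case=> [r s|r s|a b] /=; [exact: prolong_dD|exact: prolong_dM|].
by rewrite !prolong_d_const mulrC.
Qed.

Definition cone_to_prolong : {rmorphism cone_alg delta _ k -> prolong_alg delta _ k} :=
  sym_morph (pm_evalD tau_rel_prolong) (pm_evalZ tau_rel_prolong).

Lemma cone_to_prolong_const r :
  cone_to_prolong (dalg_const (cone_alg delta) k r) =
  dalg_const (prolong_alg delta) k r.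
Proof. exact: sym_morph_const. Qed.

Lemma cone_to_prolong_d r :
  cone_to_prolong (dalg_d (cone_alg delta) k r) = dalg_d (prolong_alg delta) k r.
Proof.
rewrite [LHS]sym_morph_gen; exact: (pm_evalE tau_rel_prolong (Mgen R r)).
Qed.

Lemma cone_ind (P : cone_alg delta _ k -> Prop) :
  (forall r, P (dalg_const (cone_alg delta) k r)) ->
  (forall r, P (dalg_d (cone_alg delta) k r)) ->
  (forall x y, P x -> P y -> P (x + y)) ->
  (forall x y, P x -> P y -> P (x * y)) -> forall x, P x.
Proof. exact: sym_pmod_ind. Qed.

Lemma cone_to_prolong_surj (x : prolong_alg delta _ k) :
  exists y, cone_to_prolong y = x.
Proof.
elim/qpiW: x; elim/sym_pmod_ind => [r|r|x y [x' ex] [y' ey]|x y [x' ex] [y' ey]].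
- by exists (dalg_const (cone_alg delta) k r); rewrite cone_to_prolong_const.
- by exists (dalg_d (cone_alg delta) k r); rewrite cone_to_prolong_d.
- by exists (x' + y'); rewrite !rmorphD ex ey.
- by exists (x' * y'); rewrite !rmorphM ex ey.
Qed.
End TauToD.

(** * The embedding of the prolongation into the cone *)

Section Embedding.
Variables (K : fieldType) (delta : K -> K) (X : variety K).
Variables (P : prolongation delta X) (C : prolongation_cone delta X).

(** By [mor_eq_local] this property characterizes the embedding. *)
Definition over_charts (f : mor P C) :=
  forall (V : opens X) (hV : affine_open V),
    exists h : pre (proj P) V `<=` pre f (pre (proj C) V),
      forall b, pull h (chart C hV b) = chart P hV (cone_to_prolong delta (kmap V) b).

Lemma embedding_ex : exists f : mor P C, over_charts f.
Proof.
pose I := {V : opens X | affine_open V}.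
have [|x|i j x|f fP] := @glue_charts P C I
  (fun i => pre (proj C) (sval i)) (fun i => pre (proj P) (sval i))
  (fun i => cone_alg delta _ (kmap (sval i))) (fun i => chart C (proj2_sig i))
  (fun i => chart P (proj2_sig i) \o cone_to_prolong delta (kmap (sval i))).
- by move=> i; exact: chart_Spec.
- by have [V [Vx hV]] := scheme_affine (proj P x); exists (exist _ V hV).
- move: i j => [V hV] [V' hV'] /= Vx V'x.
  have [W [Wx WVV' hW]] := affine_base (conj Vx V'x : meet V V' (proj P x)).
  (* Restriction to a smaller affine open commutes with [tau r |-> d r]; it is
     checked on the generators of the cone algebra. *)
  have ref U (hU : affine_open U) : W `<=` U ->
      refines (fun i : I => chart C (proj2_sig i))
        (fun i : I => chart P (proj2_sig i) \o cone_to_prolong delta (kmap (sval i)))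
        (exist _ W hW) (exist _ U hU).
    move=> WU; have kC : pre (proj C) W `<=` pre (proj C) U by move=> y; exact: WU.
    have kP : pre (proj P) W `<=` pre (proj P) U by move=> y; exact: WU.
    suff H b : exists b', res kC (chart C hU b) = chart C hW b' /\
        res kP (chart P hU (cone_to_prolong delta (kmap U) b)) =
        chart P hW (cone_to_prolong delta (kmap W) b').
      by exists kC, kP => b; exact: H.
    elim/cone_ind: b => [r|r|b c [b' [eb eb']] [c' [ec ec']]
                                       |b c [b' [eb eb']] [c' [ec ec']]].
    + exists (dalg_const (cone_alg delta) (kmap W) (res WU r)).
      by rewrite !cone_to_prolong_const !chart_const !(comor_res WU).
    + exists (dalg_d (cone_alg delta) (kmap W) (res WU r)).
      by rewrite !cone_to_prolong_d !(chart_d _ hW WU).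
    + by exists (b' + c'); rewrite !rmorphD eb ec eb' ec'.
    + by exists (b' * c'); rewrite !rmorphM eb ec eb' ec'.
  exists (exist _ W hW); split=> //; apply: ref => y /WVV' [] //.
by exists f => V hV; exact: (fP (exist _ V hV)).
Qed.

Variables (f : mor P C) (fV : over_charts f).

Lemma embedding_const (V : opens X) (hV : affine_open V)
    (h : pre (proj P) V `<=` pre f (pre (proj C) V)) r :
  pull h (comor (proj C) V r) = comor (proj P) V r.
Proof.
have [h' e] := fV hV; rewrite (pull_irr h h') -(chart_const C hV) e.
by rewrite cone_to_prolong_const chart_const.
Qed.

Lemma embedding_d (V : opens X) (hV : affine_open V)
    (h : pre (proj P) V `<=` pre f (pre (proj C) V)) r :
  pull h (chart C hV (dalg_d (cone_alg delta) (kmap V) r)) =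
  chart P hV (dalg_d (prolong_alg delta) (kmap V) r).
Proof. by have [h' e] := fV hV; rewrite (pull_irr h h') e cone_to_prolong_d. Qed.

Lemma embedding_over : mor_eq (comp_mor (proj C) f) (proj P).
Proof.
apply: mor_eq_local => x.
have [V [Vx hV]] := scheme_affine (proj P x); have [h e] := fV hV.
exists V, _, idfun, (pre (proj P) V), h, (fun=> id); split=> // r.
by rewrite (pull_comp h (fun=> id) h) !pull_id (embedding_const hV).
Qed.

Lemma embedding_closed : closed_immersion f.
Proof.
apply: closed_immersion_charts => y.
have [V [Vy hV]] := scheme_affine (proj C y); have [h e] := fV hV.
exists (pre (proj C) V); split=> //.
exists (pre (proj P) V), h, _, _, (chart P hV), (chart C hV),
  (cone_to_prolong delta (kmap V)).
split=> //; [|exact: chart_Spec|exact: chart_Spec|exact: cone_to_prolong_surj].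
by move=> z; rewrite /pre /preim /= -(embedding_over.1 z).
Qed.
End Embedding.

(** Both composites send the generator [tau r] to [d (f^* r)]. *)
Lemma embedding_natural (K : fieldType) (delta : K -> K) (X Y : variety K)
    (f : mor X Y)
    (PX : prolongation delta X) (CX : prolongation_cone delta X)
    (PY : prolongation delta Y) (CY : prolongation_cone delta Y)
    (iX : mor PX CX) (iY : mor PY CY) (f1 : mor PX PY) (fC : mor CX CY) :
  over_charts iX -> over_charts iY -> induced f f1 -> induced f fC ->
  mor_eq (comp_mor fC iX) (comp_mor iY f1).
Proof.
move=> hX hY [e1 d1] [eC dC]; apply: mor_eq_local => x.
have [W [Wx hW]] := scheme_affine (f (proj PX x)).
have [V [Vx VW hV]] := affine_base (Wx : pre f W (proj PX x)).
have [kX eX] := hX V hV; have [kY eY] := hY W hW.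
have kC : pre (proj CX) V `<=` pre fC (pre (proj CY) W).
  move=> y Vy; rewrite /pre /preim /= (eC.1 y : proj CY (fC y) = f (proj CX y)).
  exact: VW.
have k1 : pre (proj PX) V `<=` pre f1 (pre (proj PY) W).
  move=> y Vy; rewrite /pre /preim /= (e1.1 y : proj PY (f1 y) = f (proj PX y)).
  exact: VW.
have kL : pre (proj PX) V `<=` pre (comp_mor fC iX) (pre (proj CY) W).
  by move=> y Vy; exact: (kC _ (kX _ Vy)).
have kR : pre (proj PX) V `<=` pre (comp_mor iY f1) (pre (proj CY) W).
  by move=> y Vy; exact: (kY _ (k1 _ Vy)).
exists (pre (proj CY) W), _, (chart CY hW), (pre (proj PX) V), kL, kR.
split=> //; first exact: chart_Spec.
have pull_const (A : dalg K) (QX : rel_Spec A X) (QY : rel_Spec A Y)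
    (g : mor QX QY) (k : pre (proj QX) V `<=` pre g (pre (proj QY) W)) r :
    mor_eq (comp_mor (proj QY) g) (comp_mor f (proj QX)) ->
    pull k (comor (proj QY) W r) = comor (proj QX) V (pull VW r).
  move=> [_ e].
  have l1 : pre (proj QX) V `<=` pre (comp_mor (proj QY) g) W by exact: k.
  have l2 : pre (proj QX) V `<=` pre (comp_mor f (proj QX)) W.
    by move=> y; exact: VW.
  have := e W _ l1 l2 r.
  rewrite (pull_comp l1 (fun=> id) k) (pull_comp l2 VW (fun=> id)).
  by rewrite !pull_id.
elim/cone_ind => [r|r|a b ea eb|a b ea eb]; last 2 first.
- by rewrite !rmorphD ea eb.
- by rewrite !rmorphM ea eb.
- rewrite (pull_comp kL kC kX) (pull_comp kR kY k1) chart_const.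
  rewrite (embedding_const hY hW) (pull_const _ _ _ _ _ _ eC).
  by rewrite (embedding_const hX hV) (pull_const _ _ _ _ _ _ e1).
- rewrite (pull_comp kL kC kX) (pull_comp kR kY k1) (dC _ _ hV hW VW).
  by rewrite (embedding_d hX) (embedding_d hY) (d1 _ _ hV hW VW).
Qed.

Theorem corollary4p3 (K : closedFieldType) (delta : K -> K)
    (hdelta : is_derivation delta) (e : K) (he : delta e = 1) :
  exists iota : forall (X : variety K)
      (P : prolongation delta X) (C : prolongation_cone delta X), mor P C,
    (forall (X : variety K)
        (P : prolongation delta X) (C : prolongation_cone delta X),
      closed_immersion (iota X P C) /\
      mor_eq (comp_mor (proj C) (iota X P C)) (proj P)) /\
    (forall (X Y : variety K) (f : mor X Y), over_K f ->
      forall (PX : prolongation delta X) (CX : prolongation_cone delta X)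
        (PY : prolongation delta Y) (CY : prolongation_cone delta Y)
        (f1 : mor PX PY) (fC : mor CX CY),
      induced f f1 -> induced f fC ->
      mor_eq (comp_mor fC (iota X PX CX)) (comp_mor (iota Y PY CY) f1)).
Proof.
pose iota X P C := projT1 (cid (@embedding_ex K delta X P C)).
have iotaP X P C : over_charts (iota X P C) by rewrite /iota; case: cid.
exists iota; split=> [X P C|X Y f _ PX CX PY CY f1 fC].
  by split; [exact: embedding_closed|exact: embedding_over].
exact: embedding_natural.
Qed.
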